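(* Let $\alpha\in(0,1)$, $\theta=\alpha/2$, and let $0=t_0<t_1<\dots<t_N=T$ be a time mesh with steps $\tau_k=t_k-t_{k-1}$ and ratios $r_k=\tau_k/\tau_{k-1}$ satisfying $4/7\le r_k\le r^*$ for $2\le k\le N$, for some finite $r^*$. Let $\{\lambda_k\}_{k=0}^N$ be nonnegative constants with $0<\sum_{k=0}^N\lambda_k\le\Lambda$, where $\Lambda>0$ is a constant independent of the time stepsizes. Suppose that the nonnegative sequences $\{\xi^k\}_{k=1}^N$ and $\{\eta^k\}_{k=1}^N$ are bounded and that the nonnegative sequence $\{w^k\}_{k=0}^N$ satisfies $$\sum_{k=1}^nA^{(n)}_{n-k}\,(w^k-w^{k-1})\le\sum_{k=0}^n\lambda_{n-k}w^k+\xi^n+\eta^n,\qquad1\le n\le N,$$ where $A^{(n)}_{n-k}$ are the Alikhanov kernels and $P^{(n)}_{n-j}$ their complementary kernels (see context). If $\tau_n\le\left(\frac{4}{33\,\Gamma(2-\alpha)\Lambda}\right)^{1/\alpha}$ for all $1\le n\le N$, then for every $1\le n\le N$ $$w^n\le C_{n,\alpha}\Big(w^0+\max_{1\le k\le n}\sum_{j=1}^kP^{(k)}_{k-j}(\xi^j+\eta^j)\Big),$$ where $C_{n,\alpha}:=2E_\alpha\!\left(\tfrac{77}{8}\Lambda t_n^\alpha\right)$ (which depends on $\alpha$ but is robust, i.e. remains bounded, as $\alpha\to1$), and, further, $$w^n\le C_{n,\alpha}\Big(w^0+\max_{1\le k\le n}\sum_{j=1}^kP^{(k)}_{k-j}\xi^j+\frac{11}{4}\,\omega_{1+\alpha}(t_n)\max_{1\le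 k\le n}\eta^k\Big).$$
   Context: $\omega_\mu(t)=t^{\mu-1}/\Gamma(\mu)$; $E_\alpha(z)=\sum_{k=0}^\infty z^k/\Gamma(1+k\alpha)$ is the Mittag--Leffler function; $t_{n-\theta}=(1-\theta)t_n+\theta t_{n-1}$, $t_{k-1/2}=(t_k+t_{k-1})/2$. Alikhanov kernels: $$a^{(n)}_{n-k}=\frac1{\tau_k}\int_{t_{k-1}}^{\min\{t_k,t_{n-\theta}\}}\omega_{1-\alpha}(t_{n-\theta}-s)\,ds\quad(1\le k\le n),$$ $$b^{(n)}_{n-k}=\frac{2}{\tau_k(\tau_k+\tau_{k+1})}\int_{t_{k-1}}^{t_k}(s-t_{k-1/2})\,\omega_{1-\alpha}(t_{n-\theta}-s)\,ds\quad(1\le k\le n-1),$$ $A^{(1)}_0=a^{(1)}_0$, and for $n\ge2$: $A^{(n)}_0=a^{(n)}_0+b^{(n)}_1/r_n$; $A^{(n)}_{n-k}=a^{(n)}_{n-k}+b^{(n)}_{n-k+1}/r_k-b^{(n)}_{n-k}$ for $2\le k\le n-1$; $A^{(n)}_{n-1}=a^{(n)}_{n-1}-b^{(n)}_{n-1}$. Complementary kernels: $P^{(n)}_0=1/A^{(n)}_0$ and $$P^{(n)}_{n-j}=\frac{1}{A^{(j)}_0}\sum_{k=j+1}^n\big(A^{(k)}_{k-j-1}-A^{(k)}_{k-j}\big)P^{(n)}_{n-k},\qquad1\le j\le n-1,$$ so that $\sum_{j=k}^nP^{(n)}_{n-j}A^{(j)}_{j-k}=1$ for $1\le k\le n\le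 N$. *)

(* Defs.v *)
From HB Require Import structures.
From mathcomp Require Import all_boot all_order all_algebra.
From mathcomp Require Import all_classical all_reals all_analysis.
Import Order.TTheory GRing.Theory Num.Theory.
Import numFieldNormedType.Exports.

Set Implicit Arguments.
Unset Strict Implicit.
Unset Printing Implicit Defensive.

Local Open Scope classical_set_scope.
Local Open Scope ring_scope.

(* Euler's integral; only meaningful for x > 0. *)
Definition Gamma (R : realType) (x : R) : R :=
  \int[lebesgue_measure]_(s in `]0%R, +oo[) (s `^ (x - 1) * expR (- s)).

Definition omega (R : realType) (mu x : R) : R := x `^ (mu - 1) / Gamma mu.

Definition mittag_leffler (R : realType) (alpha z : R) : R :=
  limn (series (fun k : nat => z ^+ k / Gamma (1 + k%:R * alpha))).

Definition tau (R : realType) (t : nat -> R) (k : nat) : R := t k - t k.-1.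

Definition step_ratio (R : realType) (t : nat -> R) (k : nat) : R :=
  tau t k / tau t k.-1.

(* The point t_{n-theta}. *)
Definition toff (R : realType) (t : nat -> R) (theta : R) (n : nat) : R :=
  (1 - theta) * t n + theta * t n.-1.

Definition tmid (R : realType) (t : nat -> R) (k : nat) : R :=
  (t k + t k.-1) / 2.

(* All kernels below are indexed by position instead of by lag:
   [kernel_a t alpha theta n k] is a^{(n)}_{n-k}, and likewise for
   b^{(n)}_{n-k}, A^{(n)}_{n-k} and P^{(n)}_{n-k}.  Hence b^{(n)}_{n-k+1}
   is at position k.-1, and A^{(n)}_0 at position n. *)

Definition kernel_a (R : realType) (t : nat -> R) (alpha theta : R)
    (n k : nat) : R :=
  (tau t k)^-1 *
  \int[lebesgue_measure]_(s in `[t k.-1, Num.min (t k) (toff t theta n)])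
    omega (1 - alpha) (toff t theta n - s).

Definition kernel_b (R : realType) (t : nat -> R) (alpha theta : R)
    (n k : nat) : R :=
  2 / (tau t k * (tau t k + tau t k.+1)) *
  \int[lebesgue_measure]_(s in `[t k.-1, t k])
    ((s - tmid t k) * omega (1 - alpha) (toff t theta n - s)).

Definition kernel_A (R : realType) (t : nat -> R) (alpha theta : R)
    (n k : nat) : R :=
  let a := kernel_a t alpha theta n in
  let b := kernel_b t alpha theta n in
  if (n <= 1)%N then a k
  else if k == n then a n + b n.-1 / step_ratio t n
  else if k == 1%N then a 1%N - b 1%N
  else a k + b k.-1 / step_ratio t k - b k.

(* [compl_upto A n m i] is P^{(n)}_i for i <= m; at stage m the value P^{(n)}_m
   (position j = n - m) is computed from P^{(n)}_0, ..., P^{(n)}_{m-1}. *)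
Fixpoint compl_upto (R : realType) (A : nat -> nat -> R) (n m : nat) {struct m}
    : nat -> R :=
  if m is m'.+1 then
    let P := compl_upto A n m' in
    let j := (n - m)%N in
    fun i => if (i <= m')%N then P i
             else (A j j)^-1 *
                  \sum_(j.+1 <= k < n.+1) (A k j.+1 - A k j) * P (n - k)%N
  else fun=> (A n n)^-1.

Definition kernel_P (R : realType) (A : nat -> nat -> R) (n j : nat) : R :=
  compl_upto A n (n - j) (n - j).

Lemma compl_upto_le (R : realType) (A : nat -> nat -> R) (n m i : nat) :
  (i <= m)%N -> compl_upto A n m i = compl_upto A n i i.
Proof.
elim: m => [|m IHm]; first by rewrite leqn0 => /eqP ->.
by rewrite leq_eqVlt => /predU1P[-> //|]; rewrite ltnS /= => le_im; rewrite le_im IHm.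
Qed.

Lemma kernel_Pnn (R : realType) (A : nat -> nat -> R) (n : nat) :
  kernel_P A n n = 1 / A n n.
Proof. by rewrite /kernel_P subnn div1r. Qed.

Lemma kernel_P_rec (R : realType) (A : nat -> nat -> R) (n j : nat) :
  (1 <= j < n)%N ->
  kernel_P A n j =
    1 / A j j * \sum_(j.+1 <= k < n.+1) (A k j.+1 - A k j) * kernel_P A n k.
Proof.
case/andP=> _ lt_jn; rewrite /kernel_P div1r.
have [m def_m] : {m | (n - j = m.+1)%N}.
  by exists (n - j).-1; rewrite prednK // subn_gt0.
rewrite def_m /= ltnn -def_m subKn ?(ltnW lt_jn) //.
congr (_ * _); rewrite !big_nat; apply: eq_bigr => k /andP[lt_jk _].
rewrite (@compl_upto_le _ A n m) // -ltnS -def_m.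
by rewrite ltn_sub2l.
Qed.

Lemma kernel_P_complementary (R : realType) (A : nat -> nat -> R) (n k : nat) :
  (forall j : nat, (1 <= j <= n)%N -> A j j != 0) -> (1 <= k <= n)%N ->
  \sum_(k <= j < n.+1) kernel_P A n j * A j k = 1.
Proof.
move=> A_neq0 /andP[k_gt0 le_kn].
have [d def_d] : {d | (n - k = d)%N} by exists (n - k)%N.
elim: d k k_gt0 le_kn def_d => [|d IHd] k k_gt0 le_kn def_d.
  have -> : k = n by apply/eqP; rewrite eqn_leq le_kn -subn_eq0 def_d eqxx.
  rewrite big_nat1 kernel_Pnn div1r mulVf // A_neq0 // leqnn andbT.
  exact: leq_trans le_kn.
have lt_kn : (k < n)%N by rewrite -subn_gt0 def_d.
rewrite big_ltn ?ltnS // kernel_P_rec ?k_gt0 // mulrAC div1r mulVf; last first.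
  by rewrite A_neq0 // k_gt0.
rewrite mul1r -big_split /= -[RHS](IHd k.+1) ?subnS ?def_d //.
by apply: eq_bigr => j _; rewrite mulrBl -!(mulrC (kernel_P _ _ _)) subrK.
Qed.

(* The maximum of f 1, ..., f n, for n >= 1. *)
Definition max1n (R : realType) (f : nat -> R) (n : nat) : R :=
  \big[Num.max/f 1%N]_(1 <= k < n.+1) f k.

(* The constant C_{n,alpha}, with x = t_n. *)
Definition gronwall_const (R : realType) (Lambda alpha x : R) : R :=
  2 * mittag_leffler alpha (77 / 8 * Lambda * x `^ alpha).

(* Main.v *)
(** For [n] fixed, the kernels are averages and centred first moments of the
    increasing convex function [g s = omega (1 - alpha) (t_{n-theta} - s)].
    With [r_k >= 4 / 7] one gets [b <= (7 / 11) a], hence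
    [A >= (4 / 11) a], while convexity gives
    [g t_{k-1} <= A^{(n)}_{n-k} <= g t_k], so that [A] is monotone in [k] and
    the complementary kernels [P] are nonnegative.  The functions
    [v_k = omega (1 + k alpha)] satisfy
    [v_k t = \int_0^t omega (1 - alpha) (t - s) v_{k+1}' s ds] (Beta integral),
    and comparing this integral cell by cell with [sum A (v_{k+1}(t_l) -
    v_{k+1}(t_{l-1}))], by Chebyshev's inequality if [v_{k+1}'] decreases and at
    the cost of one index shift, i.e. of a factor [7 / 4], if it increases,
    yields [sum_{j<n} P v_k(t_j) <= (77 / 16) v_{k+1}(t_n)].  Summing over [k]
    bounds [sum_{j<n} P E_alpha(mu t_j^alpha)] by
    [(77 / 16) (E_alpha(mu t_n^alpha) - 1) / mu], which is what the induction
    proving the Gronwall inequality needs. *)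

Require Import Defs.
From HB Require Import structures.
From mathcomp Require Import all_boot all_order all_algebra.
From mathcomp Require Import all_classical all_reals all_analysis.
From mathcomp Require Import measurable_realfun.
From mathcomp Require Import ring lra.
Import Order.TTheory GRing.Theory Num.Theory.
Import numFieldNormedType.Exports.

Set Implicit Arguments.
Unset Strict Implicit.
Unset Printing Implicit Defensive.

Local Open Scope classical_set_scope.
Local Open Scope ring_scope.

(** The sums over [j < n] are forced by the increasing case: there [v_{k+1}'] on cell [l] is
    compared with the mean slope on cell [l + 1], so the comparison at [t_j] involves [t_{j+1}] and
    must stop at [j = n - 1]. The remaining term is paid for by the step restriction, which gives
    [Lambda * P n n <= 1 / 3]; solving for [w n] then costs a factor [3 / 2], below the announced 2.
    Constants: [11 / 4] is the reciprocal of [4 / 11], [77 / 16] is [11 / 4] times [7 / 4], and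
    [77 / 8] is twice that, because the induction feeds back the bound [2 * E * G] and needs
    [2 * Lambda * (77 / 16) / mu = 1]. The [- 1] in the bound on the Mittag-Leffler sums leaves
    exactly the room for the data term [G]. Two facts on Euler's integral carry the special
    functions: a Tonelli computation, giving the Beta integral and the functional equation, and the
    bound [Gamma (1 + x) >= A^x e^(-A)], giving positivity, convergence of the Mittag-Leffler series
    and its uniformity as [alpha] tends to 1. *)

(** * Affine change of variables and integrals of powers *)

(** Lebesgue measure and [|c|] times its image under [phi] agree on half-open intervals, hence
    everywhere. Both signs of [c] occur: dilations for the Beta integral, the reflection
    [s |-> x - s] for the kernels. *)
Lemma ge0_integral_affine (R : realType) (c d : R) (f : R -> \bar R) :
  c != 0 -> measurable_fun [set: R] f -> (forall x, (0 <= f x)%E) ->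
  (\int[lebesgue_measure]_x f x =
   `|c|%:E * \int[lebesgue_measure]_x f (c * x + d)%R)%E.
Proof.
move=> c0 mf f0.
pose phi := (fun x : R => c * x + d) : measurableTypeR R -> measurableTypeR R.
have mphi : measurable_fun setT phi.
  by apply: measurable_funD => //; apply: measurable_funM.
have absc0 : 0 <= `|c| by [].
pose pm :=
  measure_function_pushforward__canonical__measure_function_Measure
    (@lebesgue_measure R) mphi.
pose m : {measure set (measurableTypeR R) -> \bar R} :=
  mscale (NngNum absc0) pm.
have mE A : measurable A -> lebesgue_measure A = m A.
  apply: lebesgue_measure_unique => _ [[a b]] _ <-.
  change (lebesgue_measure `]a, b] = `|c|%:E * lebesgue_measure (phi @^-1` `]a, b]))%E.
  have [cp|cn] := ltP 0 c.
    rewrite (_ : phi @^-1` _ = `](a - d) / c, (b - d) / c]%classic); last first.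
      apply/seteqP; split=> x /=; rewrite !in_itv /phi /= ltr_pdivrMr// ler_pdivlMr//;
      by move=> /andP[h1 h2]; apply/andP; split; lra.
    rewrite !lebesgue_measure_itv /= !lte_fin ltr_pM2r ?invr_gt0//.
    rewrite ltrD2r; case: ifPn => _; last by rewrite mule0.
    by rewrite -!EFinD -EFinM gtr0_norm//; congr EFin; field; rewrite gt_eqF.
  have {}cn : c < 0 by rewrite lt_neqAle c0.
  rewrite (_ : phi @^-1` _ = `[(b - d) / c, (a - d) / c[%classic); last first.
    apply/seteqP; split=> x /=; rewrite !in_itv /phi /= ltr_ndivlMr// ler_ndivrMr//;
    by move=> /andP[h1 h2]; apply/andP; split; lra.
  rewrite !lebesgue_measure_itv /= !lte_fin ltr_nM2r ?invr_lt0//.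
  rewrite ltrD2r; case: ifPn => _; last by rewrite mule0.
  by rewrite -!EFinD -EFinM ltr0_norm//; congr EFin; field; rewrite lt_eqF.
rewrite (@eq_measure_integral _ _ _ _ m)//; last by move=> A mA _; exact: mE.
rewrite ge0_integral_mscale//; congr (_ * _)%E.
by rewrite ge0_integral_pushforward.
Qed.

Lemma continuous_powR_gt0 (R : realType) (p x : R) :
  0 < x -> {for x, continuous (fun y : R => y `^ p)}.
Proof.
move=> x0; apply: differentiable_continuous; apply/derivable1_diffP.
exact: (@ex_derive _ _ _ _ _ _ _ (is_derive1_powR p x0)).
Qed.

Lemma measurable_powRB1 (R : realType) (p : R) (D : set R) :
  measurable_fun D (fun x : R => (x `^ (p - 1))%:E).
Proof. by apply/measurable_EFinP; apply: measurable_funTS; apply: measurable_powR. Qed.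

Lemma integral_powR_gt0 (R : realType) (p a b : R) : 0 < p -> 0 < a < b ->
  (\int[lebesgue_measure]_(x in `[a, b]) (x `^ (p - 1))%:E =
   ((b `^ p - a `^ p) / p)%:E)%E.
Proof.
move=> p0 /andP[a0 ab].
have c x : 0 < x -> {for x, continuous (fun x : R => x `^ p / p)}.
  by move=> x0; apply: cvgMl; exact: continuous_powR_gt0.
rewrite (@continuous_FTC2 _ _ (fun x => x `^ p / p) _ _ ab).
- by rewrite -EFinB mulrBl.
- apply: continuous_in_subspaceT => x; rewrite inE /= in_itv /= => /andP[ax _].
  by apply: continuous_powR_gt0; exact: lt_le_trans ax.
- split.
  + move=> x; rewrite in_itv /= => /andP[ax _].
    have x0 : 0 < x := lt_trans a0 ax.
    apply: derivableM => //.
    exact: (@ex_derive _ _ _ _ _ _ _ (is_derive1_powR p x0)).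
  + exact/cvg_at_right_filter/c.
  + by apply/cvg_at_left_filter/c; exact: lt_trans ab.
- move=> x; rewrite in_itv /= => /andP[ax _].
  have x0 : 0 < x := lt_trans a0 ax.
  rewrite derive1E; have h := is_derive1_powR p x0.
  rewrite deriveMr//= (@derive_val _ _ _ _ _ _ _ h).
  by rewrite mulrA mulVf ?mul1r// gt_eqF.
Qed.

(** For [p < 1] the integrand is singular at 0, so the interval is exhausted by the segments
    [[u n, b]] and monotone convergence applies, the primitive tending to 0 at 0. *)
Lemma integral_powR0 (R : realType) (p b : R) : 0 < p -> 0 < b ->
  (\int[lebesgue_measure]_(x in `]0%R, b]) (x `^ (p - 1))%:E =
   (b `^ p / p)%:E)%E.
Proof.
move=> p0 b0.
(* [n.+2] rather than [n.+1], so that already [u 0 < b]. *)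
pose u n : R := b / n.+2%:R.
have u0 n : 0 < u n by rewrite /u divr_gt0.
have ub n : u n < b by rewrite /u ltr_pdivrMr// ltr_pMr// ltr1n.
have cu : u @ \oo --> (0 : R).
  rewrite -(mulr0 b); apply: cvgMr.
  by have := @cvg_harmonic R; rewrite -cvg_shiftS.
have -> : `]0%R, b]%classic = \bigcup_n `[u n, b]%classic.
  apply/seteqP; split=> x /=.
    rewrite in_itv /= => /andP[x0 xb].
    have : \forall n \near \oo, u n < x by apply: cvgr_lt cu _ x0.
    by case=> n _ /(_ n (leqnn n)) /= unx; exists n => //=; rewrite in_itv /= ltW.
  by move=> [n _] /=; rewrite !in_itv /= => /andP[/(lt_le_trans (u0 n)) -> ->].
have cI : (\int[lebesgue_measure]_(x in `[u n, b]) (x `^ (p - 1))%:E)%E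
    @[n --> \oo] --> ((b `^ p / p)%:E)%E.
  have -> : (fun n => \int[lebesgue_measure]_(x in `[u n, b]) (x `^ (p - 1))%:E)%E
      = (fun n => ((b `^ p - (u n) `^ p) / p)%:E).
    by apply/funext => n; rewrite integral_powR_gt0// u0 ub.
  apply: cvg_EFin; first exact: nearW.
  rewrite /comp /=; apply: cvgMl; rewrite -[X in _ --> X]subr0.
  apply: cvgB; first exact: cvg_cst.
  by have /cvg_at_rightP := @powR_cvg0 R p p0; apply.
rewrite -(cvg_lim _ cI)//; apply/esym/cvg_lim => //.
apply: ge0_nondecreasing_set_cvg_integral => //.
- apply/nondecreasing_seqP => n; rewrite subsetEset; apply: subset_itvr.
  by rewrite bnd_simp /u ler_pM2l// lef_pV2 ?posrE// ler_nat.
- by move=> n; exact: measurable_powRB1.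
- by move=> n x _; rewrite lee_fin powR_ge0.
Qed.

Lemma integral_powR (R : realType) (p a b : R) : 0 < p -> 0 <= a < b ->
  (\int[lebesgue_measure]_(x in `]a, b[) (x `^ (p - 1))%:E =
   ((b `^ p - a `^ p) / p)%:E)%E.
Proof.
move=> p0 /andP[]; rewrite le_eqVlt => /predU1P[<-|a0] ab.
  rewrite integral_itv_bndo_bndc; last exact: measurable_powRB1.
  by rewrite integral_powR0// powR0 ?subr0// gt_eqF.
rewrite integral_itv_bndo_bndc; last exact: measurable_powRB1.
rewrite integral_itv_obnd_cbnd; last exact: measurable_powRB1.
by rewrite integral_powR_gt0// a0.
Qed.

(** * Gamma and Beta integrals *)

(** The cut-off is built in because [powR] does not vanish on negative reals. Gamma and Beta thus
    become integrals over the whole line, where translations and Tonelli need no care about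
    domains. *)
Definition pos_power (R : realType) (p x : R) : R :=
  if 0 < x then x `^ (p - 1) else 0.

Definition gamma_integrand (R : realType) (p x : R) : R :=
  pos_power p x * expR (- x).

Lemma pos_power_ge0 (R : realType) (p x : R) : 0 <= pos_power p x.
Proof. by rewrite /pos_power; case: ifP => // _; exact: powR_ge0. Qed.

Lemma gamma_integrand_ge0 (R : realType) (p x : R) : 0 <= gamma_integrand p x.
Proof. by rewrite mulr_ge0 ?pos_power_ge0 ?expR_ge0. Qed.

Lemma measurable_pos_power (R : realType) (p : R) :
  measurable_fun [set: R] (pos_power p).
Proof.
apply: measurable_fun_ifT => //; first exact: measurable_fun_ltr.
Qed.

Lemma measurable_gamma_integrand (R : realType) (p : R) :
  measurable_fun [set: R] (gamma_integrand p).
Proof.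
apply: measurable_funM; first exact: measurable_pos_power.
by apply: measurableT_comp => //; exact: measurable_oppr.
Qed.

Lemma gammaE (R : realType) (p : R) :
  Gamma p = fine (\int[lebesgue_measure]_x (gamma_integrand p x)%:E).
Proof.
rewrite /Gamma /Rintegral integral_mkcond; congr fine.
apply: eq_integral => x _; rewrite patchE /gamma_integrand /pos_power.
rewrite mem_setE in_itv /= andbT.
by case: ifP; rewrite ?mul0r.
Qed.

(** With [x = 2 p y], [p ln x = p ln (2 p) + p ln y] and [ln y < y], so [K = (2 p)^p] works. Half of
    the exponential decay is kept for integrability. *)
Lemma powR_le_expR_half (R : realType) (p : R) : 0 < p ->
  exists2 K : R, 0 <= K & forall x, 1 < x -> x `^ (p - 1) <= K * expR (x / 2).
Proof.
move=> p0; exists (expR (p * ln (2 * p))); first exact: expR_ge0.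
move=> x x1; have x0 : 0 < x by exact: lt_trans x1.
apply: (@le_trans _ _ (x `^ p)); first by apply: ler_powR; lra.
rewrite {1}/powR gt_eqF// -expRD ler_expR.
have -> : p * ln (2 * p) + x / 2 = p * (ln (2 * p) + x / (2 * p)).
  by field; rewrite gt_eqF.
have y0 : 0 < x / (2 * p) by rewrite divr_gt0// mulr_gt0.
have -> : ln x = ln (2 * p) + ln (x / (2 * p)).
  rewrite -lnM ?posrE//; last exact: mulr_gt0.
  by congr (ln _); field; rewrite gt_eqF.
by rewrite ler_pM2l// lerD2l; exact/ltW/ln_sublinear.
Qed.

Lemma gamma_fin (R : realType) (p : R) : 0 < p ->
  (\int[lebesgue_measure]_x (gamma_integrand p x)%:E)%E \is a fin_num.
Proof.
move=> p0; have [K K0 hK] := powR_le_expR_half p0.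
rewrite ge0_fin_numE; last first.
  by apply: integral_ge0 => x _; rewrite lee_fin gamma_integrand_ge0.
pose f1 := (fun x : R => x `^ (p - 1)) \_ `]0, 1].
(* [K e^(x/2) e^(-x)] is [2 K] times the exponential density of rate [1 / 2], whose integral is
   1. *)
pose f2 := fun x => (2 * K) * exponential_pdf 2^-1 x.
have h : (0 : R) < 2^-1 by [].
have f10 x : 0 <= f1 x.
  by rewrite /f1 patchE; case: ifP => // _; exact: powR_ge0.
have f20 x : 0 <= f2 x by rewrite !mulr_ge0// exponential_pdf_ge0// ltW.
have m1 : measurable_fun [set: R] f1.
  apply/(measurable_restrictT (fun x : R => x `^ (p - 1))) => //.
  apply: measurable_funTS.
  exact: measurable_powR.
have m2 : measurable_fun [set: R] f2.
  by apply: measurable_funM => //; exact: measurable_exponential_pdf.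
apply: (@le_lt_trans _ _ (\int[lebesgue_measure]_x ((f1 x)%:E + (f2 x)%:E))%E).
  apply: ge0_le_integral => //.
  - by move=> x _; rewrite lee_fin gamma_integrand_ge0.
  - by apply/measurable_EFinP; exact: measurable_gamma_integrand.
  - by apply: emeasurable_funD; exact/measurable_EFinP.
  move=> x _; rewrite -EFinD lee_fin /gamma_integrand /pos_power.
  case: ifPn => x0; last by rewrite mul0r addr_ge0.
  have [x1|x1] := leP x 1.
    rewrite /f1 patchE mem_setE in_itv /= x0 x1 /=.
    apply: (@le_trans _ _ (x `^ (p - 1))); last by rewrite lerDl.
    by rewrite ler_piMr ?powR_ge0// -expR0 ler_expR; lra.
    apply: (@le_trans _ _ (f2 x)); last by rewrite lerDr.
  rewrite /f2 exponential_pdfE; last by rewrite ltW.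
  apply: (@le_trans _ _ (K * expR (x / 2) * expR (- x))).
    by rewrite ler_wpM2r ?expR_ge0// hK.
  rewrite -mulrA -expRD le_eqVlt; apply/orP; left; apply/eqP.
  rewrite (_ : x / 2 - x = - 2^-1 * x); last by field.
  by field.
rewrite ge0_integralD//; last 4 first.
- by move=> x _; rewrite lee_fin.
- exact/measurable_EFinP.
- by move=> x _; rewrite lee_fin.
- exact/measurable_EFinP.
apply: lte_add_pinfty.
  have -> : (\int[lebesgue_measure]_x (f1 x)%:E =
             \int[lebesgue_measure]_(x in `]0%R, 1%R]) (x `^ (p - 1))%:E)%E.
    by rewrite [RHS]integral_mkcond restrict_EFin.
  by rewrite integral_powR0// ltry.
under eq_integral do rewrite EFinM.
rewrite ge0_integralZl//.
- by rewrite integral_exponential_pdf// mule1 ltry.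
- by apply/measurable_EFinP; exact: measurable_exponential_pdf.
- by move=> x _; rewrite lee_fin exponential_pdf_ge0// ltW.
- by rewrite lee_fin mulr_ge0.
Qed.

Lemma EFin_gamma (R : realType) (p : R) : 0 < p ->
  ((Gamma p)%:E = \int[lebesgue_measure]_x (gamma_integrand p x)%:E)%E.
Proof. by move=> p0; rewrite gammaE fineK ?gamma_fin. Qed.

Lemma integral_expRN (R : realType) (A : R) :
  (\int[lebesgue_measure]_(s in `[A, +oo[) (expR (- s))%:E =
   (expR (- A))%:E)%E.
Proof.
have dexpN (y : R) : is_derive y 1 (fun s => - expR (- s)) (expR (- y)).
  by apply: is_derive_eq; rewrite mulrN1 opprK.
have cexpN (y : R) : {for y, continuous (fun s => expR (- s))}.
  by apply: continuous_comp; [exact: opp_continuous|exact: continuous_expR].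
rewrite (@ge0_continuous_FTC2y _ _ (fun s => - expR (- s)) _ 0).
- by rewrite EFinN oppeK add0e.
- by move=> s _; exact: expR_ge0.
- by apply: continuous_subspaceT => y; exact: cexpN.
- by rewrite -oppr0; apply: cvgN; exact: cvgr_expR.
- by move=> y _; exact: (@ex_derive _ _ _ _ _ _ _ (dexpN y)).
- by apply: cvgN; apply/cvg_at_right_filter; exact: cexpN.
- by move=> y _; rewrite derive1E (@derive_val _ _ _ _ _ _ _ (dexpN y)).
Qed.

(* Restricting Euler's integral to [A, +oo[, where s^x >= A^x. *)
Lemma gamma1D_ge (R : realType) (A x : R) : 0 <= A -> 0 <= x ->
  A `^ x * expR (- A) <= Gamma (1 + x).
Proof.
move=> A0 x0; rewrite -lee_fin EFin_gamma; last by rewrite ltr_wpDr.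
have mexpN : measurable_fun [set: R] (fun s : R => (expR (- s))%:E).
  by apply/measurable_EFinP; apply: measurableT_comp => //; exact: measurable_oppr.
have mg : measurable_fun [set: R] (fun s => (gamma_integrand (1 + x) s)%:E).
  by apply/measurable_EFinP; exact: measurable_gamma_integrand.
have g0 s : (0 <= (gamma_integrand (1 + x) s)%:E)%E.
  by rewrite lee_fin gamma_integrand_ge0.
apply: (@le_trans _ _
  (\int[lebesgue_measure]_(s in `]A, +oo[) (gamma_integrand (1 + x) s)%:E)%E);
  last exact: ge0_subset_integral.
rewrite EFinM -integral_expRN -integral_itv_obnd_cbnd; last exact: measurable_funTS.
rewrite -ge0_integralZl//; last 2 first.
- exact: measurable_funTS.
- by rewrite lee_fin powR_ge0.
apply: ge0_le_integral => //.
- by move=> s _; rewrite -EFinM lee_fin mulr_ge0 ?powR_ge0 ?expR_ge0.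
- by apply: measurable_funeM; exact: measurable_funTS.
- exact: measurable_funTS.
- move=> s /=; rewrite in_itv /= andbT => As.
  rewrite -EFinM lee_fin /gamma_integrand /pos_power (le_lt_trans A0 As).
  rewrite ler_wpM2r ?expR_ge0// addrC addrA addNr add0r.
  by rewrite ge0_ler_powR ?nnegrE// ltW// (le_lt_trans A0).
Qed.

(** Extended-real valued, so that no finiteness has to be shown beforehand: [gammaM_beta] determines
    its value. *)
Definition beta_integral (R : realType) (a b : R) : \bar R :=
  (\int[lebesgue_measure]_x (pos_power a x * pos_power b (1 - x))%:E)%E.

Lemma measurable_pos_power_sub (R : realType) (p t : R) :
  measurable_fun [set: R] (fun x => pos_power p (t - x)).
Proof.
apply: measurableT_comp; first exact: measurable_pos_power.
by apply: measurable_funB => //; exact: measurable_cst.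
Qed.

Lemma conv_pos_power (R : realType) (a b t : R) : 0 < t ->
  (\int[lebesgue_measure]_x (pos_power a x * pos_power b (t - x))%:E =
   (t `^ (a + b - 1))%:E * beta_integral a b)%E.
Proof.
move=> t0; have tn0 : t != 0 by rewrite gt_eqF.
have m s : measurable_fun [set: R]
    (fun x => (pos_power a x * pos_power b (s - x))%:E).
  apply/measurable_EFinP; apply: measurable_funM.
    exact: measurable_pos_power.
  exact: measurable_pos_power_sub.
have ge0 s x : (0 <= (pos_power a x * pos_power b (s - x))%:E)%E.
  by rewrite lee_fin mulr_ge0 ?pos_power_ge0.
have mt : measurable_fun [set: R]
    (fun x => (pos_power a (t * x + 0) * pos_power b (t - (t * x + 0)))%:E).
  apply: (measurableT_comp (m t)).
  by apply: measurable_funD => //; apply: measurable_funM.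
apply: (etrans (ge0_integral_affine 0 tn0 (m t) (ge0 t))).
have absc0 : (0 <= `|t|%:E)%E by rewrite lee_fin.
apply: (etrans (esym (@ge0_integralZl _ _ R lebesgue_measure _ measurableT
  _ mt _ (fun x _ => ge0 t (t * x + 0)) absc0))).
have w0 : (0 <= (t `^ (a + b - 1))%:E)%E by rewrite lee_fin powR_ge0.
apply: (etrans _ (@ge0_integralZl _ _ R lebesgue_measure _ measurableT
  _ (m 1) _ (fun x _ => ge0 1 x) w0)).
apply: eq_integral => x _; rewrite -!EFinM; congr EFin.
rewrite addr0 (_ : t - t * x = t * (1 - x)); last by ring.
rewrite /pos_power !pmulr_rgt0//.
case: ifPn => x0; last by rewrite !(mul0r, mulr0).
case: ifPn => x1; last by rewrite !mulr0.
rewrite !powRM ?(ltW x0) ?(ltW x1) ?(ltW t0)// gtr0_norm//.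
rewrite (_ : a + b - 1 = 1 + (a - 1) + (b - 1)); last by ring.
rewrite !(@powRD _ t) ?tn0 ?implybT//.
by rewrite powRr1 ?(ltW t0)//; ring.
Qed.

(** Euler's argument: translate the second variable by [x], swap the integrals by Tonelli, and
    recognise the inner one as [e^(-y)] times the convolution of two powers, a multiple of
    [y^(a+b-1)] by scaling. *)
Lemma gammaM_beta (R : realType) (a b : R) : 0 < a -> 0 < b ->
  ((Gamma a * Gamma b)%:E = beta_integral a b * (Gamma (a + b))%:E)%E.
Proof.
move=> a0 b0.
rewrite EFinM (EFin_gamma a0) (EFin_gamma b0) (EFin_gamma (addr_gt0 a0 b0)).
have ge0 p (x : R) : (0 <= (gamma_integrand p x)%:E)%E.
  by rewrite lee_fin gamma_integrand_ge0.
have mg p : measurable_fun [set: R] (fun x => (gamma_integrand p x)%:E).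
  by apply/measurable_EFinP; exact: measurable_gamma_integrand.
have beta0 : (0 <= beta_integral a b)%E.
  by apply: integral_ge0 => x _; rewrite lee_fin mulr_ge0 ?pos_power_ge0.
pose f (z : measurableTypeR R * measurableTypeR R) : \bar R :=
  (gamma_integrand a z.1 * gamma_integrand b (z.2 - z.1))%:E.
have mf : measurable_fun [set: measurableTypeR R * measurableTypeR R] f.
  apply/measurable_EFinP; apply: measurable_funM.
    apply: measurableT_comp; first exact: measurable_gamma_integrand.
    exact: measurable_fst.
  apply: measurableT_comp; first exact: measurable_gamma_integrand.
  by apply: measurable_funB; [exact: measurable_snd|exact: measurable_fst].
have f0 z : (0 <= f z)%E by rewrite lee_fin mulr_ge0 ?gamma_integrand_ge0.
transitivity (\int[lebesgue_measure]_x \int[lebesgue_measure]_y f (x, y))%E.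
  rewrite muleC -ge0_integralZl//; first last.
  - by apply: integral_ge0.
  - exact: mg.
  apply: eq_integral => x _; rewrite muleC.
  rewrite (@ge0_integral_affine _ 1 (- x) (fun x => (gamma_integrand b x)%:E))//.
  have mgx : measurable_fun [set: R]
      (fun y => (gamma_integrand b (1 * y + - x))%:E).
    apply: (measurableT_comp (mg b)).
    by apply: measurable_funD => //; apply: measurable_funM.
  have g0 : (0 <= (gamma_integrand a x)%:E)%E by exact: ge0.
  rewrite normr1 mul1e.
  apply: (etrans (esym (@ge0_integralZl _ _ R lebesgue_measure _ measurableT
    _ mgx _ (fun y _ => ge0 b (1 * y + - x)) g0))).
  by apply: eq_integral => y _; rewrite /f /= mul1r EFinM.
rewrite fubini_tonelli//.
rewrite -ge0_integralZl//.
apply: eq_integral => y _; rewrite /f /=.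
rewrite {3}/gamma_integrand /pos_power; case: ifPn => y0; last first.
  rewrite mul0r mule0; apply: integral0_eq => x _.
  rewrite /gamma_integrand /pos_power; case: ifP => x0; last by rewrite !mul0r.
  by rewrite (_ : 0 < y - x = false) ?mul0r ?mulr0//; apply/negbTE; lra.
rewrite EFinM muleA [X in (X * _)%E]muleC -conv_pos_power// muleC -ge0_integralZl//.
- apply: eq_integral => x _; rewrite -EFinM; congr EFin.
  rewrite /gamma_integrand (_ : - y = - x + - (y - x)); last by ring.
  by rewrite expRD; ring.
- apply/measurable_EFinP; apply: measurable_funM.
    exact: measurable_pos_power.
  exact: measurable_pos_power_sub.
- by move=> x _; rewrite lee_fin mulr_ge0 ?pos_power_ge0.
exact: mg.
Qed.

Lemma Gamma1 (R : realType) : Gamma (1 : R) = 1.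
Proof.
rewrite /Gamma /Rintegral.
under eq_integral do rewrite subrr powRr0 mul1r.
rewrite integral_itv_obnd_cbnd.
  by rewrite integral_expRN oppr0 expR0.
apply/measurable_EFinP; apply: measurable_funTS.
by apply: measurableT_comp => //; exact: measurable_oppr.
Qed.

(** The product formula at [b = 1], where [B(p, 1) = 1 / p]; this replaces integration by parts. *)
Lemma Gamma1D (R : realType) (p : R) : 0 < p -> Gamma (1 + p) = p * Gamma p.
Proof.
move=> p0; have := gammaM_beta p0 (@ltr01 R); rewrite Gamma1 mulr1.
have -> : (beta_integral p 1 = (p^-1)%:E)%E.
  have <- : (\int[lebesgue_measure]_(x in `]0%R, 1%R[) (x `^ (p - 1))%:E =
    (p^-1)%:E)%E.
    by rewrite integral_powR ?lexx ?ltr01// powR1 powR0 ?gt_eqF// subr0 div1r.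
  rewrite [RHS]integral_mkcond; apply: eq_integral => x _.
  rewrite patchE mem_setE in_itv /= /pos_power subr_gt0.
  case: ifP => _; last by rewrite mul0r.
  by case: ifP => _; rewrite ?mulr0// subrr powRr0 mulr1.
rewrite -EFinM => -[->]; rewrite addrC mulrA mulfV ?mul1r//.
by rewrite gt_eqF.
Qed.

(** [gamma1D_ge] at [A = 1] bounds [p * Gamma p] below by [e^(-1)]. *)
Lemma Gamma_gt0 (R : realType) (p : R) : 0 < p -> 0 < Gamma p.
Proof.
move=> p0; rewrite -(pmulr_rgt0 _ p0) -Gamma1D//.
apply: lt_le_trans (gamma1D_ge (@ler01 R) (ltW p0)).
by rewrite powR1 mul1r expR_gt0.
Qed.

Lemma integral_beta (R : realType) (a b t : R) : 0 < a -> 0 < b -> 0 < t ->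
  (\int[lebesgue_measure]_(x in `]0%R, t[)
     (x `^ (a - 1) * (t - x) `^ (b - 1))%:E =
   (t `^ (a + b - 1) * (Gamma a * Gamma b / Gamma (a + b)))%:E)%E.
Proof.
move=> a0 b0 t0.
transitivity (\int[lebesgue_measure]_x
    (pos_power a x * pos_power b (t - x))%:E)%E.
  rewrite [LHS]integral_mkcond; apply: eq_integral => x _.
  rewrite patchE mem_setE in_itv /= /pos_power subr_gt0.
  by have [] := ltP 0 x; have [] := ltP x t; rewrite ?mul0r ?mulr0.
rewrite conv_pos_power// EFinM; congr (_ * _)%E.
have G0 : 0 < Gamma (a + b) by rewrite Gamma_gt0// addr_gt0.
rewrite EFinM (gammaM_beta a0 b0) -muleA -EFinM mulfV ?mule1//.
by rewrite gt_eqF.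
Qed.

#[local] Opaque Gamma.

(** * The Mittag-Leffler function *)

Lemma Gamma1D_gt0 (R : realType) (alpha : R) (k : nat) : 0 < alpha ->
  0 < Gamma (1 + k%:R * alpha).
Proof. by move=> a0; rewrite Gamma_gt0// ltr_pwDl// mulr_ge0// ltW. Qed.

(** [A] is chosen with [A^(k alpha) = (2 z + 1)^k]; then [gamma1D_ge] bounds the [k]-th term by
    [e^A (z / (2 z + 1))^k <= e^A 2^(-k)]. The bound depends on [alpha] only through [A], which also
    serves robustness. *)
Lemma ml_series_le (R : realType) (alpha z : R) (n : nat) :
  0 < alpha -> 0 <= z ->
  series (fun k : nat => z ^+ k / Gamma (1 + k%:R * alpha)) n
    <= 2 * expR ((2 * z + 1) `^ alpha^-1).
Proof.
move=> a0 z0; set A := (_ `^ _).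
have h k : z ^+ k / Gamma (1 + k%:R * alpha) <= expR A * 2^-1 ^+ k.
  have GA : (2 * z + 1) ^+ k * expR (- A) <= Gamma (1 + k%:R * alpha).
    apply: le_trans (gamma1D_ge (powR_ge0 _ alpha^-1 : 0 <= A) _); last first.
      by rewrite mulr_ge0// ltW.
    rewrite /A -powRrM mulrCA mulVf ?gt_eqF// mulr1 powR_mulrn//.
    by rewrite addr_ge0// mulr_ge0.
  rewrite ler_pdivrMr ?Gamma1D_gt0//.
  apply: le_trans (ler_wpM2l _ GA); last by rewrite mulr_ge0 ?expR_ge0 ?exprn_ge0.
  have -> : expR A * 2^-1 ^+ k * ((2 * z + 1) ^+ k * expR (- A)) =
     (2^-1 * (2 * z + 1)) ^+ k.
    rewrite exprMn expRN; set E := expR A.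
    have E0 : E != 0 by rewrite gt_eqF// expR_gt0.
    by field.
  by apply: lerXn2r; rewrite ?nnegrE; lra.
apply: (@le_trans _ _ (\sum_(0 <= k < n) expR A * 2^-1 ^+ k)).
  by rewrite /series /=; apply: ler_sum => k _; exact: h.
rewrite -mulr_sumr mulrC ler_wpM2r ?expR_ge0//.
have -> : \sum_(0 <= k < n) (2^-1 : R) ^+ k = 2 * (1 - 2^-1 ^+ n).
  elim: n => [|n IH]; first by rewrite big_nil expr0 subrr mulr0.
  by rewrite big_nat_recr//= IH exprS; field.
have : 0 <= (2^-1 : R) ^+ n by rewrite exprn_ge0.
by lra.
Qed.

Lemma ml_series_nondecreasing (R : realType) (alpha z : R) :
  0 < alpha -> 0 <= z ->
  nondecreasing_seq (series (fun k : nat => z ^+ k / Gamma (1 + k%:R * alpha))).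
Proof.
move=> a0 z0; apply: nondecreasing_series => k _ _.
by rewrite divr_ge0 ?exprn_ge0// ltW// Gamma1D_gt0.
Qed.

Lemma ml_series_is_cvg (R : realType) (alpha z : R) : 0 < alpha -> 0 <= z ->
  cvgn (series (fun k : nat => z ^+ k / Gamma (1 + k%:R * alpha))).
Proof.
move=> a0 z0; apply: nondecreasing_is_cvgn; first exact: ml_series_nondecreasing.
by exists (2 * expR ((2 * z + 1) `^ alpha^-1)) => _ [n _ <-]; exact: ml_series_le.
Qed.

Lemma ml_series_le_mittag_leffler (R : realType) (alpha z : R) (n : nat) :
  0 < alpha -> 0 <= z ->
  series (fun k : nat => z ^+ k / Gamma (1 + k%:R * alpha)) n
    <= mittag_leffler alpha z.
Proof.
move=> a0 z0; apply: nondecreasing_cvgn_le; last exact: ml_series_is_cvg.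
exact: ml_series_nondecreasing.
Qed.

Lemma mittag_leffler_ge1 (R : realType) (alpha z : R) :
  0 < alpha -> 0 <= z -> 1 <= mittag_leffler alpha z.
Proof.
move=> a0 z0; apply: le_trans (ml_series_le_mittag_leffler 1 a0 z0).
by rewrite /series /= big_nat1 expr0 mul0r addr0 Gamma1 divr1.
Qed.

Lemma mittag_leffler_le (R : realType) (alpha y z : R) :
  0 < alpha -> 0 <= y <= z -> mittag_leffler alpha y <= mittag_leffler alpha z.
Proof.
move=> a0 /andP[y0 yz]; have z0 : 0 <= z := le_trans y0 yz.
apply: limr_le; first exact: ml_series_is_cvg.
apply: nearW => n; apply: le_trans (ml_series_le_mittag_leffler n a0 z0).
rewrite /series /=; apply: ler_sum => k _.
rewrite ler_wpM2r ?invr_ge0 ?(ltW (Gamma1D_gt0 _ _))//.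
by apply: lerXn2r; rewrite ?nnegrE.
Qed.

(** Near 1 one has [b > 1 / 2], so the exponent [b^-1] in [ml_series_le] is at most 2 and its bound
    becomes uniform in [b]. *)
Lemma gronwall_const_bounded (R : realType) (Lambda x : R) :
  0 <= Lambda -> 0 <= x ->
  exists M : R, \forall b \near 1^'-, `|gronwall_const Lambda b x| <= M.
Proof.
(* [1 + x] dominates [x^b] for all [b] in []0, 1[], whether [x] is below or above 1. *)
move=> L0 x0; pose Z := 77 / 8 * Lambda * (1 + x).
have Z0 : 0 <= Z by rewrite /Z !mulr_ge0// addr_ge0.
exists (4 * expR ((2 * Z + 1) `^ 2)); near=> b.
have bhalf : 2^-1 < b by near: b; apply: nbhs_left_gt; lra.
have b1 : b < 1 by near: b; exact: nbhs_left_lt.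
have b0 : 0 < b by lra.
have y0 : 0 <= 77 / 8 * Lambda * x `^ b by rewrite !mulr_ge0 ?powR_ge0.
rewrite /gronwall_const ger0_norm; last first.
  by rewrite mulr_ge0// (le_trans ler01)// mittag_leffler_ge1.
have yZ : 77 / 8 * Lambda * x `^ b <= Z.
  rewrite ler_wpM2l ?mulr_ge0//; apply: (@le_trans _ _ ((1 + x) `^ b)).
    by rewrite ge0_ler_powR ?nnegrE ?addr_ge0 ?(ltW b0)// lerDr.
  by rewrite ler1_powR ?lerDl// ltW.
apply: (@le_trans _ _ (2 * mittag_leffler b Z)).
  by rewrite ler_wpM2l// mittag_leffler_le// y0.
have -> : 4 * expR ((2 * Z + 1) `^ 2) = 2 * (2 * expR ((2 * Z + 1) `^ 2)) by ring.
rewrite ler_wpM2l//; apply: limr_le; first exact: ml_series_is_cvg.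
apply: nearW => n; apply: le_trans (ml_series_le n b0 Z0) _.
rewrite ler_wpM2l// ler_expR ler_powR//; first by rewrite lerDr mulr_ge0.
by rewrite -[leRHS]invrK lef_pV2 ?posrE// ltW.
Unshelve. all: by end_near. Qed.

(** * Moments of convex functions *)

Lemma integrable_segment (R : realType) (u v : R) (f : R -> R) :
  (forall s, s \in `[u, v] -> {for s, continuous f}) ->
  lebesgue_measure.-integrable `[u, v] (EFin \o f).
Proof.
move=> cf; apply: continuous_compact_integrable; first exact: segment_compact.
by apply: continuous_in_subspaceT => s; rewrite inE => /cf.
Qed.

(** Common shape of the polynomials with which [g] and its moment are compared below: the linear
    term integrates to zero by symmetry. *)
Lemma Rintegral_centered_quadratic (R : realType) (u v c0 c1 c2 : R) : u < v ->
  \int[lebesgue_measure]_(s in `[u, v])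
     (c0 + c1 * (s - (v + u) / 2) + c2 * (s - (v + u) / 2) ^+ 2) =
  c0 * (v - u) + c2 * ((v - u) ^+ 3 / 12).
Proof.
move=> uv; set m := (v + u) / 2.
pose F s := c0 * s + c1 * ((s - m) ^+ 2 / 2) + c2 * ((s - m) ^+ 3 / 3).
have dF (s : R) : is_derive s 1 F (c0 + c1 * (s - m) + c2 * (s - m) ^+ 2).
  by rewrite /F; apply: is_derive_eq; rewrite /GRing.scale /=; field.
have cF (s : R) : {for s, continuous F}.
  apply: differentiable_continuous; apply/derivable1_diffP.
  exact: (@ex_derive _ _ _ _ _ _ _ (dF s)).
rewrite /Rintegral (@continuous_FTC2 _ _ F _ _ uv).
- by rewrite -EFinB /= /F /m; field.
- apply: continuous_subspaceT => s.
  apply: cvgD; first apply: cvgD; first exact: cvg_cst.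
    by apply: cvgMr; apply: cvgB; [exact: cvg_id|exact: cvg_cst].
  by apply: cvgMr; apply: cvgM; apply: cvgB; exact: cvg_id || exact: cvg_cst.
- split.
  + by move=> s _; exact: (@ex_derive _ _ _ _ _ _ _ (dF s)).
  + exact/cvg_at_right_filter/cF.
  + exact/cvg_at_left_filter/cF.
- by move=> s _; rewrite derive1E (@derive_val _ _ _ _ _ _ _ (dF s)).
Qed.

Definition centered_moment (R : realType) (g : R -> R) (u v : R) : R :=
  \int[lebesgue_measure]_(s in `[u, v]) ((s - (v + u) / 2) * g s).

Section convex_moments.
Variables (R : realType) (x : R) (g D : R -> R).
Hypothesis g_ge0 : forall s, s < x -> 0 <= g s.
Hypothesis D_ge0 : forall s, s < x -> 0 <= D s.
(** Convexity in subgradient form, so that no derivative of [g] has to be computed. *)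
Hypothesis g_tangent :
  forall y z, y < x -> z < x -> g y + D y * (z - y) <= g z.
Hypothesis g_cont : forall s, s < x -> {for s, continuous g}.

Lemma tangent_nondecreasing y z : y <= z -> z < x -> g y <= g z.
Proof.
move=> yz zx; have yx := le_lt_trans yz zx.
apply: le_trans (g_tangent yx zx).
by rewrite lerDl mulr_ge0 ?D_ge0// subr_ge0.
Qed.

(** Add the tangent inequalities at [y] and at [z]. *)
Lemma subgradient_nondecreasing y z : y <= z -> z < x -> D y <= D z.
Proof.
rewrite le_eqVlt => /predU1P[->//|yz] zx; have yx := lt_trans yz zx.
rewrite -(@ler_pM2r _ (z - y)) ?subr_gt0//.
by have := g_tangent yx zx; have := g_tangent zx yx; lra.
Qed.

Variables (u v : R).
Hypothesis uv : u < v.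
Hypothesis vx : v < x.

Let m := (v + u) / 2.

Let mv : m < v. Proof. by rewrite /m; move: uv; lra. Qed.

Let seg_lt s : s \in `[u, v] -> s < x.
Proof. by rewrite in_itv /= => /andP[_ sv]; exact: le_lt_trans vx. Qed.

Let cont_quad (c0 c1 c2 s : R) :
  {for s, continuous (fun s => c0 + c1 * (s - m) + c2 * (s - m) ^+ 2)}.
Proof.
apply: cvgD; first apply: cvgD; first exact: cvg_cst.
  by apply: cvgMr; apply: cvgB; [exact: cvg_id|exact: cvg_cst].
by apply: cvgMr; apply: cvgM; apply: cvgB; exact: cvg_id || exact: cvg_cst.
Qed.

Let int_g : lebesgue_measure.-integrable `[u, v] (EFin \o g).
Proof. by apply: integrable_segment => s /seg_lt; exact: g_cont. Qed.

Let int_moment :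
  lebesgue_measure.-integrable `[u, v] (EFin \o (fun s => (s - m) * g s)).
Proof.
apply: integrable_segment => s /seg_lt sx.
by apply: cvgM; [apply: cvgB; [exact: cvg_id|exact: cvg_cst]|exact: g_cont].
Qed.

Let int_quad (c0 c1 c2 : R) : lebesgue_measure.-integrable `[u, v]
  (EFin \o (fun s => c0 + c1 * (s - m) + c2 * (s - m) ^+ 2)).
Proof. by apply: integrable_segment => s _; exact: cont_quad. Qed.

(** [(s - m) * (g s - g m) >= 0] by monotonicity, and the constant [g m] has zero centred moment. *)
Lemma centered_moment_ge0 : 0 <= centered_moment g u v.
Proof.
have <- : \int[lebesgue_measure]_(s in `[u, v])
    (0 + g m * (s - m) + 0 * (s - m) ^+ 2) = 0.
  by rewrite Rintegral_centered_quadratic// !mul0r addr0.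
apply: le_Rintegral => //.
move=> s /= us; have sx := seg_lt us.
rewrite mul0r addr0 add0r mulrC.
have [sm|ms] := leP s m.
  rewrite ler_wnM2l ?subr_le0//; apply: tangent_nondecreasing => //.
  exact: lt_trans vx.
by rewrite ler_wpM2l ?subr_ge0 ?(ltW ms)//; apply: tangent_nondecreasing => //; exact: ltW.
Qed.

Lemma centered_moment_le_mass : centered_moment g u v <=
  (v - u) / 2 * \int[lebesgue_measure]_(s in `[u, v]) g s.
Proof.
rewrite -RintegralZl//; apply: le_Rintegral => //.
- apply: integrable_segment => s /seg_lt sx.
  by apply: cvgMr; exact: g_cont.
- move=> s /= us; rewrite ler_wpM2r ?g_ge0 ?(seg_lt us)//.
  by move: us; rewrite in_itv /= => /andP[us sv]; lra.
Qed.

(** The right-hand side integrates [g] against the weight [1 - kappa * (s - m)], of total mass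
    [v - u]. The condition on [kappa] says that this weight is still nonnegative at [s = v], so [g]
    may be replaced by its minimum [g u]. *)
Lemma mass_sub_moment_ge (kappa : R) : 0 <= kappa -> kappa * (v - u) <= 2 ->
  g u * (v - u) <=
  \int[lebesgue_measure]_(s in `[u, v]) g s - kappa * centered_moment g u v.
Proof.
move=> k0 kuv; rewrite /centered_moment -RintegralZl// -RintegralB//; last first.
  apply: integrable_segment => s /seg_lt sx; apply: cvgMr.
  by apply: cvgM; [apply: cvgB; [exact: cvg_id|exact: cvg_cst]|exact: g_cont].
have <- : \int[lebesgue_measure]_(s in `[u, v])
    (g u + (- (kappa * g u)) * (s - m) + 0 * (s - m) ^+ 2) = g u * (v - u).
  by rewrite Rintegral_centered_quadratic// !mul0r addr0.
apply: le_Rintegral => //.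
- apply: integrable_segment => s /seg_lt sx.
  apply: cvgB; first exact: g_cont.
  apply: cvgMr; apply: cvgM; last exact: g_cont.
  by apply: cvgB; [exact: cvg_id|exact: cvg_cst].
move=> s /= us; have sx := seg_lt us.
move: us; rewrite in_itv /= => /andP[us sv].
have gus : g u <= g s by exact: tangent_nondecreasing.
have w0 : 0 <= 1 - kappa * (s - m).
  have : kappa * (s - m) <= kappa * ((v - u) / 2).
    by rewrite ler_wpM2l// /m; lra.
  by lra.
have := ler_wpM2l w0 gus; rewrite -/m; lra.
Qed.

Lemma mass_le_trapezoid :
  \int[lebesgue_measure]_(s in `[u, v]) g s <= (v - u) * ((g u + g v) / 2).
Proof.
have <- : \int[lebesgue_measure]_(s in `[u, v])
    ((g u + g v) / 2 + (g v - g u) / (v - u) * (s - m) + 0 * (s - m) ^+ 2) =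
    (v - u) * ((g u + g v) / 2).
  by rewrite Rintegral_centered_quadratic// !mul0r addr0 mulrC.
apply: le_Rintegral => //.
move=> s /= us; have sx := seg_lt us.
move: us; rewrite in_itv /= => /andP[us sv].
have vu : 0 < v - u by rewrite subr_gt0.
have vu0 : v - u != 0 by rewrite gt_eqF.
have -> : (g u + g v) / 2 + (g v - g u) / (v - u) * (s - m) + 0 * (s - m) ^+ 2
   = (g u * (v - s) + g v * (s - u)) / (v - u) by rewrite /m; field.
rewrite ler_pdivlMr//.
(* Tangents at [s], evaluated at [u] and [v] and weighted by [v - s] and [s - u]: the slope terms
   cancel and the chord inequality remains. *)
have t1 := g_tangent sx (lt_trans uv vx); have t2 := g_tangent sx vx.
have s1 : 0 <= v - s by lra.
have s2 : 0 <= s - u by lra.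
have := ler_wpM2r s1 t1; have := ler_wpM2r s2 t2; lra.
Qed.

(** The line through [(m, g m)] with the largest slope [D v] lies above [g] to the right of [m] and
    below it to the left; multiplication by [s - m] makes both comparisons point the same way. *)
Lemma centered_moment_le_subgradient :
  centered_moment g u v <= D v * ((v - u) ^+ 3 / 12).
Proof.
have <- : \int[lebesgue_measure]_(s in `[u, v])
    (0 + g m * (s - m) + D v * (s - m) ^+ 2) = D v * ((v - u) ^+ 3 / 12).
  by rewrite Rintegral_centered_quadratic// mul0r add0r.
apply: le_Rintegral => //.
move=> s /= us; have sx := seg_lt us.
move: us; rewrite in_itv /= -/m => /andP[us sv].
have mx : m < x by exact: lt_trans vx.
rewrite add0r.
have -> : g m * (s - m) + D v * (s - m) ^+ 2 = (s - m) * (g m + D v * (s - m)).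
  by ring.
have [sm|ms] := leP s m.
  rewrite ler_wnM2l ?subr_le0//; apply: le_trans (g_tangent mx sx).
  rewrite lerD2l ler_wnM2r ?subr_le0//.
  by apply: subgradient_nondecreasing => //; exact: ltW.
rewrite ler_wpM2l ?subr_ge0 ?(ltW ms)//.
have := g_tangent sx mx.
have : D s * (s - m) <= D v * (s - m).
  by rewrite ler_wpM2r ?subr_ge0 ?(ltW ms)//; exact: subgradient_nondecreasing.
lra.
Qed.

End convex_moments.

(** * Integrals of omega *)

(** Divided by [y^(-alpha)], with [q = z / y], this is [1 - alpha (q - 1) <= q^(-alpha)], which
    follows from [e^r >= 1 + r] and [ln q <= q - 1]. *)
Lemma powRN_tangent (R : realType) (alpha y z : R) :
  0 <= alpha -> 0 < y -> 0 < z ->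
  y `^ (- alpha) + alpha * y `^ (- alpha - 1) * (y - z) <= z `^ (- alpha).
Proof.
move=> a0 y0 z0; have yn0 : y != 0 by rewrite gt_eqF.
have zy0 : 0 < z / y by rewrite divr_gt0.
have -> : z `^ (- alpha) = y `^ (- alpha) * (z / y) `^ (- alpha).
  rewrite -powRM ?(ltW y0) ?(ltW zy0)//; congr (_ `^ _).
  by rewrite mulrC divfK.
have -> : y `^ (- alpha - 1) = y `^ (- alpha) / y.
  by rewrite powRD ?yn0 ?implybT// powR_inv1// ltW.
rewrite (_ : _ + _ = y `^ (- alpha) * (1 + - alpha * (z / y - 1))); last by field.
rewrite ler_wpM2l ?powR_ge0//; rewrite {1}/powR gt_eqF//.
apply: le_trans (expR_ge1Dx _); rewrite lerD2l.
rewrite ler_wnM2l ?oppr_le0//.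
by have := @le_ln1Dx R (z / y - 1); rewrite [1 + _]addrC subrK; apply; lra.
Qed.

Lemma integral_powR_sub (R : realType) (p a b x : R) :
  0 < p -> a < b -> b <= x ->
  (\int[lebesgue_measure]_(s in `]a, b[) ((x - s) `^ (p - 1))%:E =
   (((x - a) `^ p - (x - b) `^ p) / p)%:E)%E.
Proof.
move=> p0 ab bx.
have ab' : 0 <= x - b < x - a by rewrite subr_ge0 bx ltrD2l ltrN2.
apply: etrans (integral_powR p0 ab').
rewrite [LHS]integral_mkcond [RHS]integral_mkcond.
rewrite [RHS](@ge0_integral_affine _ (-1) x)//; first last.
- by move=> s; rewrite patchE; case: ifP => // _; rewrite lee_fin powR_ge0.
- apply/(measurable_restrictT (fun s : R => (s `^ (p - 1))%:E)) => //.
  exact: measurable_powRB1.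
rewrite normrN1 mul1e; apply: eq_integral => s _.
rewrite !patchE !mem_setE !in_itv /= mulN1r [- s + x]addrC !ltrD2l !ltrN2.
by rewrite [in RHS]andbC.
Qed.

Lemma omega_ge0 (R : realType) (mu x : R) : 0 < mu -> 0 <= omega mu x.
Proof. by move=> mu0; rewrite divr_ge0 ?powR_ge0// ltW// Gamma_gt0. Qed.

Lemma omega1D (R : realType) (mu x : R) : 0 < mu -> 0 < x ->
  omega (1 + mu) x = x / mu * omega mu x.
Proof.
move=> mu0 x0; rewrite /omega Gamma1D//.
have -> : 1 + mu - 1 = 1 + (mu - 1) by ring.
rewrite (@powRD _ x 1) ?(gt_eqF x0) ?implybT// powRr1 ?(ltW x0)//.
by rewrite invfM mulrACA.
Qed.

Lemma measurable_powR_sub (R : realType) (p x : R) :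
  measurable_fun [set: R] (fun s => (x - s) `^ p).
Proof.
apply: (measurableT_comp (f := fun y : R => y `^ p)).
  exact: measurable_powR.
by apply: measurable_funB => //; exact: measurable_cst.
Qed.

Lemma measurable_omega_sub (R : realType) (mu x : R) :
  measurable_fun [set: R] (fun s => omega mu (x - s)).
Proof.
apply: measurable_funM => //.
exact: measurable_powR_sub.
Qed.

Lemma integral_omega_sub (R : realType) (mu a b x : R) :
  0 < mu -> a < b -> b <= x ->
  (\int[lebesgue_measure]_(s in `]a, b[) (omega mu (x - s))%:E =
   (omega (1 + mu) (x - a) - omega (1 + mu) (x - b))%:E)%E.
Proof.
move=> mu0 ab bx; have G0 := Gamma_gt0 mu0.
under eq_integral do rewrite /omega mulrC EFinM.
rewrite ge0_integralZl//.
- rewrite integral_powR_sub// -EFinM /omega Gamma1D// addrAC subrr add0r.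
  by congr EFin; field; rewrite !gt_eqF.
- apply/measurable_EFinP; apply: measurable_funTS.
  exact: measurable_powR_sub.
- by move=> s _; rewrite lee_fin powR_ge0.
- by rewrite lee_fin invr_ge0 ltW.
Qed.

(** The derivative in [s] of [omega (1 - alpha) (x - s)]; it serves as the subgradient [D]. *)
Definition omega_slope (R : realType) (alpha x s : R) : R :=
  alpha * (x - s) `^ (- alpha - 1) / Gamma (1 - alpha).

Lemma omega_tangent (R : realType) (alpha x y z : R) :
  0 <= alpha < 1 -> y < x -> z < x ->
  omega (1 - alpha) (x - y) + omega_slope alpha x y * (z - y)
    <= omega (1 - alpha) (x - z).
Proof.
move=> /andP[a0 a1] yx zx; have G0 : 0 < Gamma (1 - alpha).
  by rewrite Gamma_gt0// subr_gt0.
have := @powRN_tangent R alpha (x - y) (x - z) a0; rewrite !subr_gt0.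
move=> /(_ yx zx) h; rewrite /omega /omega_slope addrAC subrr add0r.
rewrite mulrAC -mulrDl ler_pM2r ?invr_gt0//.
by apply: le_trans h; rewrite lerD2l le_eqVlt; apply/orP; left; apply/eqP; ring.
Qed.

Lemma omega_sub_continuous (R : realType) (mu x s : R) : s < x ->
  {for s, continuous (fun s => omega mu (x - s))}.
Proof.
move=> sx; apply: cvgMl.
apply: (@continuous_comp _ _ _ (fun s => x - s) (fun y : R => y `^ (mu - 1))).
  by apply: cvgB; [exact: cvg_cst|exact: cvg_id].
by apply: continuous_powR_gt0; rewrite subr_gt0.
Qed.

(** * The Alikhanov kernels *)

Section alikhanov_kernels.
Variables (R : realType) (alpha theta : R) (t : nat -> R) (n : nat).
Hypothesis halpha : 0 < alpha < 1.
Hypothesis htheta : theta = alpha / 2.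
Hypothesis hmesh : forall k, (1 <= k <= n)%N -> t k.-1 < t k.
Hypothesis hratio : forall k, (2 <= k <= n)%N -> 4 / 7 <= step_ratio t k.
Hypothesis n_gt0 : (0 < n)%N.

Let x := toff t theta n.
Let g s := omega (1 - alpha) (x - s).
Let D := omega_slope alpha x.

Let alpha_gt0 : 0 < alpha. Proof. by case/andP: halpha. Qed.
Let alpha_lt1 : alpha < 1. Proof. by case/andP: halpha. Qed.
Let G_gt0 : 0 < Gamma (1 - alpha).
Proof. by rewrite Gamma_gt0// subr_gt0. Qed.

Let tau_gt0 k : (1 <= k <= n)%N -> 0 < tau t k.
Proof. by move=> /hmesh; rewrite subr_gt0. Qed.

Let t_le i j : (i <= j <= n)%N -> t i <= t j.
Proof.
move=> /andP[]; elim: j => [|j IH]; first by rewrite leqn0 => /eqP ->.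
rewrite leq_eqVlt => /predU1P[->//|ij] jn.
by apply: le_trans (IH ij (ltnW jn)) _; apply/ltW/(@hmesh j.+1); rewrite jn.
Qed.

Let tau_n_gt0 : 0 < tau t n. Proof. by rewrite tau_gt0// n_gt0 leqnn. Qed.

Let theta_bounds : 0 < theta < 1 / 2.
Proof.
by rewrite htheta; have := alpha_gt0; have := alpha_lt1; move=> ? ?; apply/andP; split; lra.
Qed.

Let x_sub : x - t n.-1 = (1 - theta) * tau t n.
Proof. by rewrite /x /toff /tau; ring. Qed.

Let x_gt : t n.-1 < x.
Proof.
by rewrite -subr_gt0 x_sub mulr_gt0// subr_gt0; case/andP: theta_bounds; lra.
Qed.

Let x_lt : x < t n.
Proof.
rewrite -subr_gt0 (_ : t n - x = theta * tau t n).
  by rewrite mulr_gt0//; case/andP: theta_bounds.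
by rewrite /x /toff /tau; ring.
Qed.

Let t_lt_x k : (k < n)%N -> t k < x.
Proof.
move=> kn; apply: le_lt_trans x_gt; apply: t_le.
by rewrite -ltnS prednK// kn leq_pred.
Qed.

Let g_ge0 s : s < x -> 0 <= g s.
Proof. by move=> _; rewrite omega_ge0// subr_gt0. Qed.

Let D_ge0 s : s < x -> 0 <= D s.
Proof. by move=> _; rewrite !mulr_ge0 ?powR_ge0 ?invr_ge0// ltW. Qed.

Let g_tangent y z : y < x -> z < x -> g y + D y * (z - y) <= g z.
Proof. by move=> yx zx; apply: omega_tangent => //; rewrite ltW. Qed.

Let g_cont s : s < x -> {for s, continuous g}.
Proof. exact: omega_sub_continuous. Qed.

Let interior k : (1 <= k < n)%N ->
  [/\ t k.-1 < t k, t k < x, t k.-1 < x & 0 < tau t k.+1].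
Proof.
move=> /andP[k1 kn]; have tk : t k.-1 < t k by rewrite hmesh// k1 ltnW.
by split=> //; [exact: t_lt_x|exact: lt_trans (t_lt_x kn)|exact: tau_gt0].
Qed.

Let kernel_aE k : (1 <= k < n)%N -> kernel_a t alpha theta n k =
  (tau t k)^-1 * \int[lebesgue_measure]_(s in `[t k.-1, t k]) g s.
Proof.
by move=> /interior[_ tx _ _]; rewrite /kernel_a (min_idPl (ltW tx)).
Qed.

Let kernel_bE k : (1 <= k < n)%N -> kernel_b t alpha theta n k =
  2 / (tau t k * (tau t k + tau t k.+1)) * centered_moment g (t k.-1) (t k).
Proof. by []. Qed.

Let tau_ratio k : (1 <= k < n)%N -> 4 / 7 * tau t k <= tau t k.+1.
Proof.
move=> /andP[k1 kn]; rewrite -ler_pdivlMr; last by rewrite tau_gt0// k1 ltnW.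
by apply: (@hratio k.+1); rewrite ltnS k1.
Qed.

Lemma kernel_b_ge0 k : (1 <= k < n)%N -> 0 <= kernel_b t alpha theta n k.
Proof.
move=> kn; have [tk tx _ tau1] := interior kn; rewrite kernel_bE//.
have tauk : 0 < tau t k by rewrite subr_gt0.
apply: mulr_ge0; last exact: (@centered_moment_ge0 _ x g D).
by rewrite ltW// divr_gt0// mulr_gt0// addr_gt0.
Qed.

(** The moment is at most half a step times the mass, so [b / a <= tau t k / (tau t k + tau t
    k.+1)], and [1 + 4 / 7 = 11 / 7]. *)
Lemma kernel_b_le_a k : (1 <= k < n)%N ->
  kernel_b t alpha theta n k <= 7 / 11 * kernel_a t alpha theta n k.
Proof.
move=> kn; have [tk tx _ tau1] := interior kn; rewrite kernel_bE// kernel_aE//.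
have tauk : 0 < tau t k by rewrite subr_gt0.
have := @centered_moment_le_mass _ x g g_ge0 g_cont (t k.-1) (t k) tx.
have I0 : 0 <= \int[lebesgue_measure]_(s in `[t k.-1, t k]) g s.
  apply: Rintegral_ge0 => s _; rewrite omega_ge0// subr_gt0.
  by case/andP: halpha.
have := tau_ratio kn; rewrite -/(tau t k).
move: I0 tauk tau1; move: (Rintegral _ _ _) => I.
move: (centered_moment _ _ _) => M; move: (tau t k) (tau t k.+1) => a b.
move=> I0 a0 b0 ab MI.
rewrite mulrAC ler_pdivrMr ?mulr_gt0 ?addr_gt0//.
have -> : 7 / 11 * (a^-1 * I) * (a * (a + b)) = 7 / 11 * I * (a + b).
  by field; rewrite gt_eqF.
have := ler_wpM2l I0 ab; lra.
Qed.

(** [mass_sub_moment_ge] with [kappa = 2 / (tau t k + tau t k.+1)], the normalisation of [b]. *)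
Lemma kernel_a_sub_b_ge k : (1 <= k < n)%N ->
  g (t k.-1) <= kernel_a t alpha theta n k - kernel_b t alpha theta n k.
Proof.
move=> kn; have [tk tx _ tau1] := interior kn; rewrite kernel_bE// kernel_aE//.
have tauk : 0 < tau t k by rewrite subr_gt0.
have s0 : 0 < tau t k + tau t k.+1 by rewrite addr_gt0.
have := @mass_sub_moment_ge _ x g D D_ge0 g_tangent g_cont _ _ tk tx
  (2 / (tau t k + tau t k.+1)).
rewrite -/(tau t k) divr_ge0 ?(ltW s0)// => /(_ isT) h.
rewrite -(@ler_pM2r _ (tau t k))//; apply: le_trans (h _) _.
  by rewrite mulrAC ler_pdivrMr// ler_wpM2l//; lra.
rewrite le_eqVlt; apply/orP; left; apply/eqP; field.
by rewrite !gt_eqF.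
Qed.

(* The ratio bound is used as [rho ^ 3 <= 3 (1 + rho)] for
   [rho = tau t k / tau t k.+1 <= 7 / 4]. *)
Lemma kernel_b_ratio_le k : (1 <= k < n)%N ->
  kernel_b t alpha theta n k / step_ratio t k.+1 <= D (t k) * tau t k.+1 / 2.
Proof.
move=> kn; have [tk tx _ tau1] := interior kn; rewrite kernel_bE//.
have tauk : 0 < tau t k by rewrite subr_gt0.
have := @centered_moment_le_subgradient _ x g D g_tangent g_cont _ _ tk tx.
have Dk := D_ge0 tx.
have := tau_ratio kn; rewrite /step_ratio -/(tau t k).
move: tauk tau1 Dk; move: (centered_moment _ _ _) (D _) => M d.
rewrite (_ : k.+1.-1 = k)//.
move: (tau t k) (tau t k.+1) => a b a0 b0 d0 ab Md.
have -> : 2 / (a * (a + b)) * M / (b / a) = 2 * M / (b * (a + b)).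
  by field; rewrite !gt_eqF ?addr_gt0.
rewrite ler_pdivrMr ?mulr_gt0 ?addr_gt0//.
apply: (@le_trans _ _ (2 * (d * (a ^+ 3 / 12)))); first lra.
have -> : 2 * (d * (a ^+ 3 / 12)) = d * (a ^+ 3 / 6) by field.
have -> : d * b / 2 * (b * (a + b)) = d * (b ^+ 2 * (a + b) / 2) by field.
rewrite ler_wpM2l//.
have ab' : a <= 7 / 4 * b by lra.
have a2 : a ^+ 2 <= 49 / 16 * b ^+ 2.
  have := @lerXn2r _ 2 a (7 / 4 * b); rewrite !nnegrE => /(_ (ltW a0)).
  by rewrite mulr_ge0 ?(ltW b0)// => /(_ isT ab'); rewrite exprMn; lra.
have := ler_wpM2r (ltW a0) a2; rewrite exprS.
have ba : 0 <= b ^+ 2 * (7 / 4 * b - a) by rewrite mulr_ge0 ?sqr_ge0 ?subr_ge0.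
have : 0 < b ^+ 2 * b by rewrite mulr_gt0 ?exprn_gt0.
move: ba; rewrite mulrBr => ba p.
by rewrite [a * _]mulrC => q; lra.
Qed.

(** Trapezoidal bound on the mean, then the tangent at [t k.-1] to replace [g (t k.-1)]. The slack
    [D (t k.-1) * tau t k / 2] is exactly what [kernel_b_ratio_le], on the preceding cell, needs to
    absorb the term [b k.-1 / r_k] of [A]. *)
Lemma kernel_a_le_g k : (1 <= k < n)%N ->
  kernel_a t alpha theta n k + D (t k.-1) * tau t k / 2 <= g (t k).
Proof.
move=> kn; have [tk tx tx' tau1] := interior kn; rewrite kernel_aE//.
have tauk : 0 < tau t k by rewrite subr_gt0.
have := @mass_le_trapezoid _ x g D g_tangent g_cont _ _ tk tx.
rewrite -/(tau t k) [leRHS]mulrC -ler_pdivrMr// [leLHS]mulrC.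
by have := g_tangent tx' tx; rewrite -/(tau t k); lra.
Qed.

Lemma kernel_ann_ge : g (t n.-1) <= kernel_a t alpha theta n n /\
  (omega (2 - alpha) (tau t n) <= 11 / 4 * (tau t n * kernel_a t alpha theta n n)).
Proof.
have aE : kernel_a t alpha theta n n = (tau t n)^-1 * omega (2 - alpha) (x - t n.-1).
  rewrite /kernel_a (min_idPr (ltW x_lt)); congr (_ * _).
  rewrite /Rintegral -integral_itv_bndo_bndc; last first.
    by apply/measurable_EFinP/measurable_funTS; exact: measurable_omega_sub.
  rewrite -integral_itv_obnd_cbnd; last first.
    by apply/measurable_EFinP/measurable_funTS; exact: measurable_omega_sub.
  rewrite integral_omega_sub ?subr_gt0//= subrr.
  rewrite (_ : 1 + (1 - alpha) = 2 - alpha); last by ring.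
  rewrite [X in _ - X](_ : _ = 0) ?subr0//.
  rewrite /omega powR0 ?mul0r// gt_eqF//.
  by have := alpha_lt1; lra.
have th := theta_bounds.
have y0 : 0 < x - t n.-1 by rewrite subr_gt0.
have om2 y : 0 < y ->
    omega (2 - alpha) y = y / (1 - alpha) * omega (1 - alpha) y.
  move=> yp; have -> : 2 - alpha = 1 + (1 - alpha) by ring.
  by apply: omega1D; rewrite ?subr_gt0.
have a1 : 0 < 1 - alpha by rewrite subr_gt0.
rewrite aE; split.
  (* The kernel equals [(1 - theta) / (1 - alpha)] times [g (t n.-1)], and [theta = alpha / 2] makes
     this ratio at least 1. *)
  rewrite om2// mulrA ler_peMl ?g_ge0//.
  rewrite x_sub mulrA mulrA ler_pdivlMr// mul1r.
  rewrite (_ : (tau t n)^-1 * (1 - theta) * tau t n = 1 - theta).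
    by rewrite htheta; have := alpha_gt0; lra.
  by field; rewrite gt_eqF.
rewrite [tau t n * _]mulrA mulfV ?gt_eqF// mul1r /omega mulrA ler_pM2r; last first.
  by rewrite invr_gt0 Gamma_gt0//; have := alpha_lt1; lra.
have e0 : 0 <= 2 - alpha - 1 by have := alpha_lt1; lra.
(* The truncated last cell keeps more than half of the step, and [2^(1 - alpha) <= 2]: a factor 2 is
   lost, within the allowed [11 / 4]. *)
have h : (tau t n / 2) `^ (2 - alpha - 1) <= (x - t n.-1) `^ (2 - alpha - 1).
  rewrite ge0_ler_powR ?nnegrE ?divr_ge0 ?(ltW tau_n_gt0) ?(ltW y0)// x_sub.
  by rewrite mulrC ler_pM2r//; case/andP: th => _; lra.
apply: le_trans (ler_wpM2l _ h) => //.
rewrite powRM ?(ltW tau_n_gt0)//.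
have : 2^-1 <= (2^-1 : R) `^ (2 - alpha - 1).
  rewrite -[leLHS]powRr1//; apply: ger_powR; first by apply/andP; split; lra.
  by have := alpha_gt0; lra.
move=> /(ler_wpM2l (powR_ge0 (tau t n) (2 - alpha - 1))).
have := powR_ge0 (tau t n) (2 - alpha - 1); lra.
Qed.

Let ratio_gt0 k : (2 <= k <= n)%N -> 0 < step_ratio t k.
Proof. by move=> /hratio; apply: lt_le_trans; lra. Qed.

Let pred_interior k : (2 <= k <= n)%N -> (1 <= k.-1 < n)%N.
Proof. by case: k. Qed.

Lemma kernel_A_sub_ge k : (1 <= k < n)%N ->
  kernel_a t alpha theta n k - kernel_b t alpha theta n k <=
  kernel_A t alpha theta n k.
Proof.
move=> /andP[k1 kn]; rewrite /kernel_A leqNgt (leq_ltn_trans k1 kn) /=.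
rewrite (ltn_eqF kn); case: eqVneq => [->//|kn1].
have k2 : (2 <= k)%N by rewrite ltn_neqAle eq_sym kn1.
rewrite lerD2r lerDl divr_ge0//; last by rewrite ltW// ratio_gt0// k2 ltnW.
by apply/kernel_b_ge0/pred_interior; rewrite k2 ltnW.
Qed.

Lemma kernel_Ann_ge : kernel_a t alpha theta n n <= kernel_A t alpha theta n n.
Proof.
rewrite /kernel_A; case: leqP => // n2; rewrite eqxx lerDl.
rewrite divr_ge0//; last by rewrite ltW// ratio_gt0// n2 leqnn.
by apply/kernel_b_ge0/pred_interior; rewrite n2 leqnn.
Qed.

Lemma kernel_A_ge_omega k : (1 <= k <= n)%N ->
  g (t k.-1) <= kernel_A t alpha theta n k.
Proof.
move=> /andP[k1]; rewrite leq_eqVlt => /predU1P[->|kn].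
  by apply: le_trans kernel_Ann_ge; case: kernel_ann_ge.
have k1n : (1 <= k < n)%N by rewrite k1.
exact: le_trans (kernel_a_sub_b_ge k1n) (kernel_A_sub_ge k1n).
Qed.

Lemma kernel_A_le_omega k : (1 <= k < n)%N ->
  kernel_A t alpha theta n k <= g (t k).
Proof.
move=> k1n; have b0 := kernel_b_ge0 k1n; have ag := kernel_a_le_g k1n.
have [tk tx tx' tau1] := interior k1n.
have Dtau : 0 <= D (t k.-1) * tau t k.
  by rewrite mulr_ge0 ?D_ge0// ltW// subr_gt0.
move: (k1n) => /andP[k1 kn]; rewrite /kernel_A leqNgt (leq_ltn_trans k1 kn) /=.
rewrite (ltn_eqF kn); case: eqVneq => [k_1|kn1].
  by move: ag b0 Dtau; rewrite k_1; lra.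
have k2 : (1 <= k.-1 < n)%N.
  by apply: pred_interior; rewrite ltn_neqAle eq_sym kn1 k1 ltnW.
have := kernel_b_ratio_le k2; rewrite prednK// => br.
by move: ag b0 br; lra.
Qed.

Lemma kernel_A_nondecreasing k : (1 <= k < n)%N ->
  kernel_A t alpha theta n k <= kernel_A t alpha theta n k.+1.
Proof.
move=> k1n; apply: le_trans (kernel_A_le_omega k1n) _.
by apply: (@kernel_A_ge_omega k.+1); case/andP: k1n.
Qed.

(** Stated with [t n] instead of [x], because the convolution identities are evaluated at mesh
    points. On an interior cell the integrand lies below [g], whose mean is [a], and [kernel_b_le_a]
    gives [a <= 11 / 4 * A]; the last cell is [kernel_ann_ge]. With monotonicity in [k], this is all
    that is used of [A] afterwards. *)
Lemma integral_omega_le_kernel_A k : (1 <= k <= n)%N ->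
  (\int[lebesgue_measure]_(s in `](t k.-1), (t k)[)
     (omega (1 - alpha) (t n - s))%:E <=
   (11 / 4 * (tau t k * kernel_A t alpha theta n k))%:E)%E.
Proof.
move=> /andP[k1]; rewrite leq_eqVlt => /predU1P[->|kn].
  rewrite integral_omega_sub ?subr_gt0//; last by rewrite hmesh// n_gt0 leqnn.
  rewrite lee_fin (_ : 1 + (1 - alpha) = 2 - alpha); last by ring.
  apply: le_trans (_ : omega (2 - alpha) (tau t n) <= _).
    rewrite lerBlDr lerDl omega_ge0//.
    by have := alpha_lt1; lra.
  have [_ h] := kernel_ann_ge; apply: le_trans h _.
  by rewrite ler_wpM2l// ler_wpM2l ?(ltW tau_n_gt0)// kernel_Ann_ge.
have k1n : (1 <= k < n)%N by rewrite k1.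
have [tk tx tx' tau1] := interior k1n.
have tauk : 0 < tau t k by rewrite subr_gt0.
have mom y : measurable_fun `](t k.-1), (t k)[
    (fun s => (omega (1 - alpha) (y - s))%:E).
  by apply/measurable_EFinP/measurable_funTS; exact: measurable_omega_sub.
apply: (@le_trans _ _ (\int[lebesgue_measure]_(s in `](t k.-1), (t k)[)
    (g s)%:E)%E).
  apply: ge0_le_integral => //.
  - by move=> s _; rewrite lee_fin omega_ge0// subr_gt0.
  - exact: mom.
  - exact: mom.
  move=> s /=; rewrite in_itv /= => /andP[_ stk].
  rewrite lee_fin /g /omega ler_pM2r ?invr_gt0//.
  rewrite addrAC subrr add0r !powRN lef_pV2 ?posrE ?powR_gt0 ?subr_gt0//.
  - rewrite ge0_ler_powR ?nnegrE ?subr_ge0 ?(ltW alpha_gt0)//.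
    + by apply/ltW/(lt_trans stk).
    + by apply/ltW/(lt_trans stk)/(lt_trans tx x_lt).
    + by rewrite lerD2r ltW.
  - by apply/(lt_trans stk)/(lt_trans tx x_lt).
  - exact: lt_trans tx.
rewrite integral_itv_bndo_bndc; last exact: mom.
rewrite integral_itv_obnd_cbnd; last first.
  by apply/measurable_EFinP/measurable_funTS; exact: measurable_omega_sub.
have ig : lebesgue_measure.-integrable `[t k.-1, t k] (EFin \o g).
  apply: integrable_segment => s; rewrite in_itv /= => /andP[_ stk].
  by apply: g_cont; exact: le_lt_trans tx.
rewrite -(fineK (integrable_fin_num _ ig))// lee_fin.
have aE := kernel_aE k1n.
have -> : fine (\int[lebesgue_measure]_(s in `[t k.-1, t k]) (EFin \o g) s)
    = tau t k * kernel_a t alpha theta n k.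
  by rewrite aE mulrA mulfV ?gt_eqF// mul1r.
have := kernel_b_le_a k1n; have := kernel_A_sub_ge k1n => Age ba.
rewrite [leRHS]mulrCA ler_pM2l//; move: Age ba; lra.
Qed.

End alikhanov_kernels.

(** * Complementary kernels *)

Section complementary_kernels.
Variables (R : realType) (A : nat -> nat -> R) (N : nat).
Hypothesis A_gt0 : forall j, (1 <= j <= N)%N -> 0 < A j j.
Hypothesis A_mono : forall m k, (m <= N)%N -> (1 <= k < m)%N ->
  A m k <= A m k.+1.

(** Induction on [n - j]: the recursion expresses [P] at [j] through later positions, with
    coefficients that are nonnegative by monotonicity. *)
Lemma kernel_P_ge0 n j : (n <= N)%N -> (1 <= j <= n)%N -> 0 <= kernel_P A n j.
Proof.
move=> nN; have [d] := ubnP (n - j)%N; elim: d j => // d IHd j + /andP[j1].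
move=> lt_d; rewrite leq_eqVlt => /predU1P[jn|jn].
  by move: j1; rewrite jn => n1; rewrite kernel_Pnn div1r invr_ge0 ltW// A_gt0// n1.
rewrite kernel_P_rec ?j1//; apply: mulr_ge0; first rewrite div1r invr_ge0.
  by rewrite ltW// A_gt0// j1 (leq_trans (ltnW jn)).
rewrite big_nat; apply: sumr_ge0 => k /andP[jk kn].
apply: mulr_ge0; first by rewrite subr_ge0 A_mono ?j1// (leq_trans _ nN).
apply: IHd; last by rewrite (leq_trans _ jk).
by rewrite -ltnS; apply: leq_trans lt_d; rewrite ltnS ltn_sub2l.
Qed.

(** Discrete counterpart of the fractional integral undoing the Caputo derivative: after exchanging
    the sums, the inner one is the complementary identity. *)
Lemma kernel_P_conv n (d : nat -> R) : (n <= N)%N ->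
  \sum_(1 <= j < n.+1) kernel_P A n j * (\sum_(1 <= l < j.+1) A j l * d l) =
  \sum_(1 <= l < n.+1) d l.
Proof.
move=> nN.
transitivity (\sum_(1 <= j < n.+1) \sum_(1 <= l < n.+1 | (l < j.+1)%N)
    kernel_P A n j * A j l * d l).
  rewrite !big_nat; apply: eq_bigr => j /andP[j1 jn].
  rewrite mulr_sumr (@big_nat_widen _ _ _ _ j.+1 n.+1)//=.
  by apply: eq_bigr => l _; rewrite mulrA.
rewrite (exchange_big_dep_nat xpredT)//= !big_nat.
apply: eq_bigr => l /andP[l1 ln].
rewrite -mulr_suml -[RHS]mul1r; congr (_ * _).
rewrite -(@kernel_P_complementary _ A n l); first last.
- by rewrite l1.
- by move=> j /andP[j1 jn]; rewrite gt_eqF// A_gt0// j1 (leq_trans jn).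
rewrite [RHS](@big_nat_widenl _ _ _ l 1)//.
Qed.

(** Truncated form of [kernel_P_conv]: its hypotheses stop before [n], since the shifted increments
    used later leave the mesh at [l = N]. *)
Lemma kernel_P_conv_le n (d V : nat -> R) (C : R) : (n <= N)%N -> 0 <= C ->
  (forall j l, (j <= N)%N -> (1 <= l <= j)%N -> 0 <= A j l) ->
  (forall l, (1 <= l < n)%N -> 0 <= d l) ->
  (forall j, (1 <= j < n)%N -> V j <= C * \sum_(1 <= l < j.+1) A j l * d l) ->
  \sum_(1 <= j < n) kernel_P A n j * V j <= C * \sum_(1 <= l < n) d l.
Proof.
move=> nN C0 A0 d0 hV; case: n nN d0 hV => [|n] nN d0 hV.
  by rewrite !big_geq// mulr0.
have [n0|n1] := leqP n 0; first by rewrite !big_geq ?mulr0.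
(* Extending [d] by 0 at the last index keeps the full sum unchanged, and the extra outer term on
   the right is nonnegative. *)
pose d' l := if (l < n.+1)%N then d l else 0.
have d'0 l : (1 <= l)%N -> 0 <= d' l.
  by move=> l1; rewrite /d'; case: ifP => // ln; rewrite d0// l1.
have -> : \sum_(1 <= l < n.+1) d l = \sum_(1 <= l < n.+2) d' l.
  rewrite [RHS]big_nat_recr//= {2}/d' ltnn addr0 !big_nat.
  by apply: eq_bigr => l /andP[_ ln]; rewrite /d' ln.
rewrite -(kernel_P_conv _ nN) mulr_sumr [leRHS]big_nat_recr//=.
rewrite -[leLHS]addr0 lerD//.
  rewrite !big_nat; apply: ler_sum => j /andP[j1 jn].
  rewrite mulrCA ler_wpM2l ?kernel_P_ge0 ?j1//; first exact: ltnW.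
  apply: le_trans (hV j _) _; first by rewrite j1.
  rewrite ler_wpM2l// !big_nat; apply: ler_sum => l /andP[l1 lj].
  by rewrite /d' (leq_trans lj)// ltnW.
rewrite mulr_ge0// mulr_ge0// ?kernel_P_ge0// ?leqnn//.
rewrite big_nat; apply: sumr_ge0 => l /andP[l1 ln].
by rewrite mulr_ge0 ?d'0// A0// l1.
Qed.

End complementary_kernels.

(** * Convolution and Chebyshev inequality for omega *)

Lemma omega1 (R : realType) (x : R) : omega 1 x = 1.
Proof. by rewrite /omega Gamma1 divr1 subrr powRr0. Qed.

Lemma omega1D0 (R : realType) (beta : R) : 0 < beta -> omega (1 + beta) 0 = 0.
Proof. by move=> b0; rewrite /omega addrAC subrr add0r powR0 ?mul0r// gt_eqF. Qed.

Lemma omega1D_le (R : realType) (beta x y : R) :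
  0 <= beta -> 0 <= x <= y -> omega (1 + beta) x <= omega (1 + beta) y.
Proof.
move=> b0 /andP[x0 xy]; rewrite /omega ler_wpM2r//.
  by rewrite invr_ge0 ltW// Gamma_gt0// ltr_pwDl.
have y0 := le_trans x0 xy.
by rewrite (_ : 1 + beta - 1 = beta) ?ge0_ler_powR ?nnegrE//; ring.
Qed.

Lemma omega_le_nonincreasing (R : realType) (beta x y : R) :
  0 < beta <= 1 -> 0 < x <= y -> omega beta y <= omega beta x.
Proof.
move=> /andP[b0 b1] /andP[x0 xy]; have y0 := lt_le_trans x0 xy.
rewrite /omega ler_pM2r ?invr_gt0 ?Gamma_gt0//.
rewrite -[beta - 1]opprB !powRN lef_pV2 ?posrE ?powR_gt0//.
by rewrite ge0_ler_powR ?nnegrE ?(ltW x0) ?(ltW y0)// subr_ge0.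
Qed.

Lemma measurable_omega (R : realType) (mu : R) :
  measurable_fun [set: R] (omega mu).
Proof.
apply: (measurable_funM (f := fun x : R => x `^ (mu - 1))).
  exact: measurable_powR.
exact: measurable_cst.
Qed.

Lemma omega_conv (R : realType) (alpha beta x : R) :
  alpha < 1 -> 0 < beta -> 0 < x ->
  (\int[lebesgue_measure]_(s in `]0%R, x[)
     (omega beta s * omega (1 - alpha) (x - s))%:E =
   (omega (1 + beta - alpha) x)%:E)%E.
Proof.
move=> a1 b0 x0; have a1' : 0 < 1 - alpha by rewrite subr_gt0.
have Gb := Gamma_gt0 b0; have Ga := Gamma_gt0 a1'.
have k0 : (0 <= ((Gamma beta * Gamma (1 - alpha))^-1)%:E)%E.
  by rewrite lee_fin invr_ge0; apply/ltW/mulr_gt0.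
have mf : measurable_fun `]0, x[
    (fun s => (s `^ (beta - 1) * (x - s) `^ (1 - alpha - 1))%:E).
  apply/measurable_EFinP/measurable_funTS; apply: measurable_funM.
    exact: measurable_powR.
  exact: measurable_powR_sub.
have f0 s : `]0, x[%classic s ->
    (0 <= (s `^ (beta - 1) * (x - s) `^ (1 - alpha - 1))%:E)%E.
  by move=> _; rewrite lee_fin mulr_ge0 ?powR_ge0.
transitivity (((Gamma beta * Gamma (1 - alpha))^-1)%:E *
  \int[lebesgue_measure]_(s in `]0%R, x[)
     (s `^ (beta - 1) * (x - s) `^ (1 - alpha - 1))%:E)%E.
  apply: (etrans _ (@ge0_integralZl _ _ R lebesgue_measure _ (measurable_itv _)
    _ mf _ f0 k0)).
  apply: eq_integral => s _; rewrite -EFinM /omega; congr EFin.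
  by rewrite mulrACA -invfM mulrC.
rewrite integral_beta// -EFinM; congr EFin; rewrite /omega addrA.
rewrite (_ : 1 + beta - alpha = beta + 1 - alpha); last by ring.
by rewrite mulrCA mulKf// mulf_neq0// gt_eqF.
Qed.

Lemma integral_omega (R : realType) (beta a b : R) : 0 < beta -> 0 <= a < b ->
  (\int[lebesgue_measure]_(s in `]a, b[) (omega beta s)%:E =
   (omega (1 + beta) b - omega (1 + beta) a)%:E)%E.
Proof.
move=> b0 ab; have G0 := Gamma_gt0 b0.
have k0 : (0 <= ((Gamma beta)^-1)%:E)%E by rewrite lee_fin invr_ge0 ltW.
have f0 (s : R) : `]a, b[%classic s -> (0 <= (s `^ (beta - 1))%:E)%E.
  by move=> _; rewrite lee_fin powR_ge0.
transitivity (((Gamma beta)^-1)%:E *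
    \int[lebesgue_measure]_(s in `]a, b[) (s `^ (beta - 1))%:E)%E.
  apply: (etrans _ (@ge0_integralZl _ _ R lebesgue_measure _ (measurable_itv _)
    _ (@measurable_powRB1 R beta _) _ f0 k0)).
  by apply: eq_integral => s _; rewrite -EFinM /omega mulrC.
rewrite (integral_powR b0 ab) -EFinM; congr EFin.
rewrite /omega Gamma1D// addrAC subrr add0r.
by field; rewrite !gt_eqF.
Qed.

(** For [beta < 1] and [a = 0] the derivative blows up at the left endpoint, where the mean value
    theorem asks only for continuity. *)
Lemma omega_MVT (R : realType) (beta a b : R) : 0 < beta -> 0 <= a < b ->
  exists2 c, a < c < b &
    omega (1 + beta) b - omega (1 + beta) a = omega beta c * (b - a).
Proof.
move=> b0 /andP[a0 ab].
have d (s : R) : s \in `]a, b[ ->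
    is_derive s 1 (fun y => y `^ beta) (beta * s `^ (beta - 1)).
  rewrite in_itv /= => /andP[sa _].
  by apply: is_derive1_powR; exact: le_lt_trans sa.
have c : {within `[a, b], continuous (fun y => y `^ beta)}.
  apply/(continuous_within_itvP _ ab); split.
  - move=> s; rewrite in_itv /= => /andP[sa _].
    by apply: continuous_powR_gt0; exact: le_lt_trans sa.
  - move: a0; rewrite le_eqVlt => /predU1P[<-|a0].
      by rewrite powR0 ?gt_eqF//; exact: powR_cvg0.
    by apply: cvg_at_right_filter; exact: continuous_powR_gt0.
  - by apply: cvg_at_left_filter; apply: continuous_powR_gt0; exact: le_lt_trans ab.
have [s + E] := MVT ab d c; rewrite in_itv /= => sab; exists s => //.
have G0 := Gamma_gt0 b0.
rewrite /omega Gamma1D// addrAC subrr add0r -mulrBl E.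
by field; rewrite !gt_eqF.
Qed.

(* Chebyshev's integral inequality for the oppositely monotone functions
   [omega beta] and [s |-> omega (1 - alpha) (x - s)], integrating
   [(f s - f c) * (h s - h c) <= 0] for the mean value point [c] of
   [omega beta]. *)
Lemma omega_chebyshev (R : realType) (alpha beta a b x : R) :
  0 <= alpha < 1 -> 0 < beta <= 1 -> 0 <= a < b -> b <= x ->
  (\int[lebesgue_measure]_(s in `]a, b[)
     (omega beta s * omega (1 - alpha) (x - s))%:E <=
   ((omega (1 + beta) b - omega (1 + beta) a) / (b - a))%:E *
   \int[lebesgue_measure]_(s in `]a, b[) (omega (1 - alpha) (x - s))%:E)%E.
Proof.
move=> /andP[al0 al1] /andP[b0 b1] ab bx.
have a1pos : 0 < 1 - alpha by rewrite subr_gt0.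
have a1' : 0 < 1 - alpha <= 1 by rewrite a1pos gerBl.
have [c /andP[ac cb] E] := omega_MVT b0 ab.
move: (ab) => /andP[a0 altb].
pose f s := omega (1 - alpha) (x - s); pose h := omega beta.
have f0 s : 0 <= f s by exact: omega_ge0.
have h0 s : 0 <= h s by exact: omega_ge0.
have mf (D : set R) : measurable_fun D (fun s => (f s)%:E).
  by apply/measurable_EFinP/measurable_funTS; exact: measurable_omega_sub.
have mh (D : set R) : measurable_fun D (fun s => (h s)%:E).
  by apply/measurable_EFinP/measurable_funTS; exact: measurable_omega.
have mhf (D : set R) : measurable_fun D (fun s => (h s * f s)%:E).
  apply/measurable_EFinP/measurable_funTS; apply: measurable_funM.
    exact: measurable_omega.
  exact: measurable_omega_sub.
have ba0 : b - a != 0 by rewrite gt_eqF// subr_gt0.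
rewrite E mulfK//.
have pw s : `]a, b[%classic s ->
    ((h s * f s)%:E + (h c * f c)%:E <= (f c)%:E * (h s)%:E + (h c)%:E * (f s)%:E)%E.
  rewrite -!EFinM -!EFinD lee_fin /= in_itv /= => /andP[sa sb].
  have [sc|cs] := leP s c.
    have h1 : h c <= h s.
      by apply: omega_le_nonincreasing; rewrite ?b0 ?b1// sc (le_lt_trans a0).
    have f1 : f s <= f c.
      apply: omega_le_nonincreasing => //; rewrite subr_gt0 (lt_le_trans cb bx) /=.
      by rewrite lerD2l lerN2.
    move: (h s) (h c) (f s) (f c) h1 f1 => hs hc fs fc h1 f1.
    have : 0 <= (hs - hc) * (fc - fs) by rewrite mulr_ge0// subr_ge0.
    clear -h1 f1; rewrite mulrBr !mulrBl; lra.
  have h1 : h s <= h c.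
    by apply: omega_le_nonincreasing; rewrite ?b0 ?b1// (ltW cs) (le_lt_trans a0 ac).
  have f1 : f c <= f s.
    apply: omega_le_nonincreasing => //; rewrite subr_gt0 (lt_le_trans sb bx) /=.
    by rewrite lerD2l lerN2 ltW.
  move: (h s) (h c) (f s) (f c) h1 f1 => hs hc fs fc h1 f1.
  have : 0 <= (hc - hs) * (fs - fc) by rewrite mulr_ge0// subr_ge0.
  clear -h1 f1; rewrite mulrBr !mulrBl; lra.
(* With the negative terms moved across, all integrands stay nonnegative. By the choice of [c], both
   the integral of [h c * f c] and that of [f c * h s] equal [K], which is finite and cancels. *)
pose K := h c * f c * (b - a).
suff : (\int[lebesgue_measure]_(s in `]a, b[) (h s * f s)%:E + K%:E <=
    (h c)%:E * \int[lebesgue_measure]_(s in `]a, b[) (f s)%:E + K%:E)%E.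
  by rewrite leeD2rE.
apply: (@le_trans _ _ (\int[lebesgue_measure]_(s in `]a, b[)
    ((h s * f s)%:E + (h c * f c)%:E))%E).
  rewrite ge0_integralD//.
  - rewrite integral_cst//= lebesgue_measure_itv /= lte_fin altb -EFinD -EFinM.
    exact: lexx.
  - by move=> s _; rewrite lee_fin mulr_ge0.
  - exact: mhf.
  - by move=> s _; rewrite lee_fin mulr_ge0.
apply: (@le_trans _ _ (\int[lebesgue_measure]_(s in `]a, b[)
    ((f c)%:E * (h s)%:E + (h c)%:E * (f s)%:E))%E).
  apply: ge0_le_integral => //.
  - by move=> s _; rewrite -EFinD lee_fin addr_ge0// mulr_ge0.
  - by apply: emeasurable_funD => //; exact: mhf.
  - by apply: emeasurable_funD; apply: measurable_funeM; [exact: mh|exact: mf].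
rewrite ge0_integralD//; first last.
- by apply: measurable_funeM; exact: mf.
- by move=> s _; rewrite -EFinM lee_fin mulr_ge0.
- by apply: measurable_funeM; exact: mh.
- by move=> s _; rewrite -EFinM lee_fin mulr_ge0.
have fc0 : (0 <= (f c)%:E)%E by rewrite lee_fin.
have hc0 : (0 <= (h c)%:E)%E by rewrite lee_fin.
have Zl k q : (0 <= k%:E)%E -> (forall s, 0 <= q s) ->
    measurable_fun `]a, b[ (fun s : R => (q s)%:E) ->
    (\int[lebesgue_measure]_(s in `]a, b[) (k%:E * (q s)%:E) =
     k%:E * \int[lebesgue_measure]_(s in `]a, b[) (q s)%:E)%E.
  by move=> k0 q0 mq; rewrite ge0_integralZl// => s _; rewrite lee_fin.
rewrite (Zl _ _ fc0 h0 (mh _)) (Zl _ _ hc0 f0 (mf _)).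
rewrite (integral_omega b0 ab) E addeC -EFinM.
by rewrite le_eqVlt; apply/orP; left; apply/eqP; congr (_ + _%:E)%E; rewrite /K mulrA [f c * _]mulrC.
Qed.

(** * Sums of Mittag-Leffler functions *)

Section mittag_leffler_sums.
Variables (R : realType) (alpha theta : R) (t : nat -> R) (N : nat).
Hypothesis halpha : 0 < alpha < 1.
Hypothesis htheta : theta = alpha / 2.
Hypothesis ht0 : t 0%N = 0.
Hypothesis hmesh : forall k, (1 <= k <= N)%N -> t k.-1 < t k.
Hypothesis hratio : forall k, (2 <= k <= N)%N -> 4 / 7 <= step_ratio t k.

Let A := kernel_A t alpha theta.
Let P := kernel_P A.

Let alpha_gt0 : 0 < alpha. Proof. by case/andP: halpha. Qed.
Let alpha_lt1 : alpha < 1. Proof. by case/andP: halpha. Qed.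

Let tau_gt0 k : (1 <= k <= N)%N -> 0 < tau t k.
Proof. by move=> /hmesh; rewrite subr_gt0. Qed.

Lemma mesh_le i j : (i <= j <= N)%N -> t i <= t j.
Proof.
move=> /andP[]; elim: j => [|j IH]; first by rewrite leqn0 => /eqP ->.
rewrite leq_eqVlt => /predU1P[->//|ij] jN.
by apply: le_trans (IH ij (ltnW jN)) _; apply/ltW/(@hmesh j.+1); rewrite jN.
Qed.

Lemma mesh_ge0 j : (j <= N)%N -> 0 <= t j.
Proof. by move=> jN; rewrite -ht0; apply: mesh_le; rewrite jN. Qed.

Lemma mesh_gt0 j : (1 <= j <= N)%N -> 0 < t j.
Proof.
move=> /andP[j1 jN]; apply: le_lt_trans (hmesh _); last by rewrite j1.
by apply: mesh_ge0; apply: leq_trans jN; exact: leq_pred.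
Qed.

Let hmesh_le n : (n <= N)%N -> forall k, (1 <= k <= n)%N -> t k.-1 < t k.
Proof. by move=> nN k /andP[k1 kn]; rewrite hmesh// k1 (leq_trans kn). Qed.

Let hratio_le n : (n <= N)%N ->
  forall k, (2 <= k <= n)%N -> 4 / 7 <= step_ratio t k.
Proof. by move=> nN k /andP[k1 kn]; rewrite hratio// k1 (leq_trans kn). Qed.

Let A_integral j l : (j <= N)%N -> (1 <= l <= j)%N ->
  (\int[lebesgue_measure]_(s in `](t l.-1), (t l)[)
     (omega (1 - alpha) (t j - s))%:E <= (11 / 4 * (tau t l * A j l))%:E)%E.
Proof.
move=> jN lj; apply: integral_omega_le_kernel_A => //.
- exact: hmesh_le.
- exact: hratio_le.
- by case/andP: lj => l1; exact: leq_trans.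
Qed.

Lemma kernel_A_mono m k : (m <= N)%N -> (1 <= k < m)%N -> A m k <= A m k.+1.
Proof.
move=> mN km; apply: kernel_A_nondecreasing => //.
- exact: hmesh_le.
- exact: hratio_le.
- by case/andP: km => _; exact: leq_trans.
Qed.

Lemma kernel_A_ge0 j l : (j <= N)%N -> (1 <= l <= j)%N -> 0 <= A j l.
Proof.
move=> jN lj; have l1N : (1 <= l <= N)%N.
  by case/andP: lj => -> lj; exact: leq_trans jN.
rewrite -(pmulr_rge0 _ (tau_gt0 l1N)) -(@pmulr_rge0 _ (11 / 4))//.
rewrite -lee_fin; apply: le_trans (A_integral jN lj).
by apply: integral_ge0 => s _; rewrite lee_fin omega_ge0// subr_gt0.
Qed.

(** The cell estimate at [l = j], where the integral is [tau^(1 - alpha) / Gamma (2 - alpha)]. The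
    step restriction takes its form from here. *)
Lemma kernel_Ann_lower j : (1 <= j <= N)%N ->
  1 <= 11 / 4 * Gamma (2 - alpha) * tau t j `^ alpha * A j j.
Proof.
move=> jN; have tj := tau_gt0 jN; have /andP[j1 jN'] := jN.
have := @A_integral j j jN'; rewrite j1 leqnn => /(_ isT).
rewrite integral_omega_sub ?subr_gt0//; last exact: hmesh.
rewrite subrr lee_fin omega1D0 ?subr_gt0// subr0.
rewrite (_ : 1 + (1 - alpha) = 2 - alpha); last by ring.
have G0 : 0 < Gamma (2 - alpha).
  by rewrite Gamma_gt0// subr_gt0 (lt_trans alpha_lt1)// ltr1n.
rewrite /omega -/(tau t j) ler_pdivrMr//.
have -> : 2 - alpha - 1 = 1 - alpha by ring.
rewrite powRB ?(gt_eqF tj) ?implybT// powRr1 ?(ltW tj)//.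
rewrite ler_pdivrMr ?powR_gt0// => h.
rewrite -(ler_pM2l tj) mulr1; apply: le_trans h _.
move: (Gamma (2 - alpha)) (tau t j `^ alpha) (A j j) (tau t j) => G p a s.
by rewrite le_eqVlt; apply/orP; left; apply/eqP; ring.
Qed.

Lemma kernel_Ann_gt0 j : (1 <= j <= N)%N -> 0 < A j j.
Proof.
move=> jN; have := kernel_Ann_lower jN; apply: contraTT.
rewrite -!leNgt -ltNge => A0; apply: le_lt_trans ltr01.
rewrite mulr_ge0_le0// !mulr_ge0 ?powR_ge0// ltW// Gamma_gt0//.
by rewrite subr_gt0 (lt_trans alpha_lt1)// ltr1n.
Qed.

Lemma kernel_Pnn_le j : (1 <= j <= N)%N ->
  P j j <= 11 / 4 * Gamma (2 - alpha) * tau t j `^ alpha.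
Proof.
move=> jN; rewrite /P kernel_Pnn ler_pdivrMr ?kernel_Ann_gt0//.
exact: kernel_Ann_lower.
Qed.

Lemma integral_mesh_split (F : R -> R) j : (j <= N)%N ->
  measurable_fun [set: R] F -> (forall s, 0 <= F s) ->
  (\int[lebesgue_measure]_(s in `]0%R, (t j)[) (F s)%:E =
   \sum_(1 <= l < j.+1)
     \int[lebesgue_measure]_(s in `](t l.-1), (t l)[) (F s)%:E)%E.
Proof.
move=> + mF F0; have mFE (D : set R) : measurable_fun D (fun s => (F s)%:E).
  by apply/measurable_EFinP; exact: measurable_funTS.
elim: j => [|j IH] jN.
  by rewrite big_geq// ht0 set_itvoo0 integral_set0.
rewrite big_nat_recr//= -IH ?(ltnW jN)//.
have tj := mesh_ge0 (ltnW jN).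
have tjj : t j < t j.+1 by apply: (@hmesh j.+1); rewrite jN.
rewrite [X in _ = (X + _)%E]integral_itv_bndo_bndc; last exact: mFE.
rewrite (@itv_bndbnd_setU _ _ _ (BRight (t j))) ?bnd_simp//.
rewrite ge0_integral_setU//; first exact: mFE.
  by move=> s _; rewrite lee_fin.
apply/disj_setPS => s [] /=; rewrite !in_itv /= => /andP[_ h1] /andP[h2 _].
by move: (le_lt_trans h1 h2); rewrite ltxx.
Qed.

Let omega_conv_sum (beta : R) j : 0 < beta -> (1 <= j <= N)%N ->
  ((omega (1 + beta - alpha) (t j))%:E = \sum_(1 <= l < j.+1)
     \int[lebesgue_measure]_(s in `](t l.-1), (t l)[)
        (omega beta s * omega (1 - alpha) (t j - s))%:E)%E.
Proof.
move=> b0 j1N; have /andP[_ jN] := j1N.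
rewrite -(integral_mesh_split jN).
- by rewrite omega_conv// mesh_gt0.
- apply: measurable_funM; first exact: measurable_omega.
  exact: measurable_omega_sub.
- by move=> s; rewrite mulr_ge0// omega_ge0// subr_gt0.
Qed.

Let sum_le_of_integrals (beta C : R) (d : nat -> R) j :
  0 < beta -> (1 <= j <= N)%N ->
  (forall l, (1 <= l <= j)%N ->
    (\int[lebesgue_measure]_(s in `](t l.-1), (t l)[)
        (omega beta s * omega (1 - alpha) (t j - s))%:E <=
     (C * (A j l * d l))%:E)%E) ->
  omega (1 + beta - alpha) (t j) <= C * \sum_(1 <= l < j.+1) A j l * d l.
Proof.
move=> b0 j1N h; rewrite -lee_fin (omega_conv_sum b0 j1N) mulr_sumr -sumEFin.
by rewrite !big_nat; apply: lee_sum => l; rewrite ltnS; exact: h.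
Qed.

(** For [beta <= 1], [omega beta] is nonincreasing while the kernel increases, so Chebyshev puts the
    mean slope of [omega (1 + beta)] on the same cell in front of the kernel integral. *)
Lemma omega_le_sum_small (beta : R) j : 0 < beta <= 1 -> (1 <= j <= N)%N ->
  omega (1 + beta - alpha) (t j) <= 11 / 4 * \sum_(1 <= l < j.+1)
    A j l * (omega (1 + beta) (t l) - omega (1 + beta) (t l.-1)).
Proof.
move=> hb j1N; have [b0 _] := andP hb; have [j1 jN] := andP j1N.
apply: sum_le_of_integrals => // l /andP[l1 lj].
have lN : (l <= N)%N := leq_trans lj jN.
have tl0 : 0 <= t l.-1 by apply: mesh_ge0; apply: leq_trans lN; exact: leq_pred.
have tl : t l.-1 < t l by rewrite hmesh// l1.
have al : 0 <= alpha < 1 by rewrite (ltW alpha_gt0) alpha_lt1.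
have ab : 0 <= t l.-1 < t l by rewrite tl0.
have lj' : t l <= t j by apply: mesh_le; rewrite lj.
apply: le_trans (omega_chebyshev al hb ab lj') _.
have D0 : 0 <= (omega (1 + beta) (t l) - omega (1 + beta) (t l.-1)) / (t l - t l.-1).
  rewrite divr_ge0 ?subr_ge0 ?(ltW tl)// omega1D_le ?(ltW b0)//.
  by rewrite tl0 ltW.
have l1j : (1 <= l <= j)%N by rewrite l1.
apply: (@le_trans _ _ (_ * (11 / 4 * (tau t l * A j l))%:E)%E).
  by apply: lee_wpmul2l; [rewrite lee_fin|exact: A_integral].
rewrite -EFinM lee_fin -/(tau t l); have tau0 : tau t l != 0.
  by rewrite gt_eqF// tau_gt0// l1.
move: (omega _ _ - _) (A j l) (tau t l) tau0 => x a s s0.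
by rewrite le_eqVlt; apply/orP; left; apply/eqP; field.
Qed.

(** For [beta >= 1], [omega beta] is nondecreasing and Chebyshev points the wrong way. On cell [l]
    it is bounded by its right-end value, which is at most the mean slope on cell [l + 1]; trading
    [tau t l] for [7 / 4 * tau t l.+1] turns that slope into an increment. Hence [j < N]. *)
Lemma omega_le_sum_large (beta : R) j : 1 <= beta -> (1 <= j < N)%N ->
  omega (1 + beta - alpha) (t j) <= 77 / 16 * \sum_(1 <= l < j.+1)
    A j l * (omega (1 + beta) (t l.+1) - omega (1 + beta) (t l)).
Proof.
move=> b1 j1N; have b0 := lt_le_trans ltr01 b1; have [j1 jN] := andP j1N.
apply: sum_le_of_integrals => //; first by rewrite j1 ltnW.
move=> l /andP[l1 lj].
have lN : (l < N)%N := leq_ltn_trans lj jN.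
have tl : t l.-1 < t l by rewrite hmesh// l1 ltnW.
have tl1 : t l < t l.+1 by apply: (@hmesh l.+1).
have tl0 : 0 <= t l.-1.
  by apply: mesh_ge0; apply: leq_trans (ltnW lN); exact: leq_pred.
have tlg0 : 0 < t l := le_lt_trans tl0 tl.
have ab : 0 <= t l < t l.+1 by rewrite (ltW tlg0).
have [c /andP[lc _] E] := omega_MVT b0 ab.
have a1 : 0 < 1 - alpha by rewrite subr_gt0.
have om_le s y : 0 <= s <= y -> omega beta s <= omega beta y.
  move=> /andP[s0 sy]; rewrite /omega ler_pM2r ?invr_gt0 ?Gamma_gt0//.
  by rewrite ge0_ler_powR ?nnegrE ?subr_ge0// (le_trans s0).
have [h hE] : {h | h = omega beta (t l)} by exists (omega beta (t l)).
have h0 : 0 <= h by rewrite hE omega_ge0.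
have jl : (1 <= l <= j)%N by rewrite l1.
apply: (@le_trans _ _ (h%:E * (11 / 4 * (tau t l * A j l))%:E)%E).
  apply: (@le_trans _ _ (h%:E * \int[lebesgue_measure]_(s in `](t l.-1), (t l)[)
      (omega (1 - alpha) (t j - s))%:E)%E); last first.
    by apply: lee_wpmul2l; [rewrite lee_fin|exact: A_integral (ltnW jN) jl].
  have mf : measurable_fun `](t l.-1), (t l)[
      (fun s => (omega (1 - alpha) (t j - s))%:E).
    by apply/measurable_EFinP/measurable_funTS; exact: measurable_omega_sub.
  have f0 s : `](t l.-1), (t l)[%classic s ->
      (0 <= (omega (1 - alpha) (t j - s))%:E)%E.
    by move=> _; rewrite lee_fin omega_ge0.
  have hE0 : (0 <= h%:E)%E by rewrite lee_fin.
  rewrite -(@ge0_integralZl _ _ R lebesgue_measure _ (measurable_itv _)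
    _ mf _ f0 hE0).
  apply: ge0_le_integral => //.
  - by move=> s _; rewrite lee_fin mulr_ge0// omega_ge0.
  - apply/measurable_EFinP/measurable_funTS; apply: measurable_funM.
      exact: measurable_omega.
    exact: measurable_omega_sub.
  - by apply: measurable_funeM; exact: mf.
  - move=> s /=; rewrite in_itv /= => /andP[s1 s2].
    rewrite -EFinM lee_fin ler_wpM2r ?omega_ge0// hE om_le//.
    by rewrite (le_trans tl0 (ltW s1)) ltW.
rewrite -EFinM lee_fin.
have hc : h * tau t l.+1 <= omega (1 + beta) (t l.+1) - omega (1 + beta) (t l).
  rewrite E hE ler_wpM2r ?subr_ge0 ?(ltW tl1)// om_le//.
  by rewrite (ltW tlg0) ltW.
have A0 : 0 <= A j l by apply: kernel_A_ge0 => //; exact: ltnW.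
have tau_ratio : 4 / 7 * tau t l <= tau t l.+1.
  rewrite -ler_pdivlMr; last by rewrite subr_gt0.
  by apply: (@hratio l.+1); rewrite ltnS l1.
have h1 : h * (4 / 7 * tau t l) <= h * tau t l.+1 by rewrite ler_wpM2l.
have := ler_wpM2l A0 (le_trans h1 hc).
move: (omega _ _ - _) (A j l) (tau t l) => x a s.
have -> : h * (11 / 4 * (s * a)) = 77 / 16 * (a * (h * (4 / 7 * s))) by field.
by move=> ?; rewrite ler_pM2l.
Qed.

(** The case [beta = alpha], where the left side of the comparison is [omega 1 = 1]. No shift
    occurs, so the term [j = n] can be kept. *)
Lemma sum_kernel_P_le n : (n <= N)%N ->
  \sum_(1 <= j < n.+1) P n j <= 11 / 4 * omega (1 + alpha) (t n).
Proof.
move=> nN; have hb : 0 < alpha <= 1 by rewrite alpha_gt0 ltW.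
pose d l := omega (1 + alpha) (t l) - omega (1 + alpha) (t l.-1).
have -> : omega (1 + alpha) (t n) = \sum_(1 <= l < n.+1) d l.
  rewrite [RHS]big_add1 /= (telescope_sumr (fun l => omega (1 + alpha) (t l)))//.
  by rewrite ht0 omega1D0// subr0.
rewrite -(kernel_P_conv kernel_Ann_gt0 d nN) mulr_sumr !big_nat.
apply: ler_sum => j /andP[j1 jn].
rewrite mulrCA -[leLHS]mulr1 ler_wpM2l//.
  by apply: (kernel_P_ge0 kernel_Ann_gt0 kernel_A_mono) => //; rewrite j1.
have := @omega_le_sum_small alpha j hb; rewrite j1 (leq_trans _ nN)// => /(_ isT).
by rewrite addrK omega1.
Qed.

(** One discrete fractional integration: with [beta = (k + 1) alpha], the two comparisons according
    to the position of [beta] relative to 1, then telescoping. *)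
Lemma sum_kernel_P_omega_le n k : (n <= N)%N ->
  \sum_(1 <= j < n) P n j * omega (1 + k%:R * alpha) (t j)
    <= 77 / 16 * omega (1 + k.+1%:R * alpha) (t n).
Proof.
move=> nN; pose beta := k.+1%:R * alpha; pose v j := omega (1 + beta) (t j).
have b0 : 0 < beta by rewrite mulr_gt0.
have -> : 1 + k%:R * alpha = 1 + beta - alpha by rewrite /beta -natr1; ring.
case: n nN => [|n] nN.
  by rewrite big_geq// mulr_ge0// omega_ge0// ltr_pwDl// ltW.
have v_le i j : (i <= j <= N)%N -> v i <= v j.
  move=> ij; apply: omega1D_le; first exact: ltW.
  rewrite mesh_le// andbT; apply: mesh_ge0.
  by case/andP: ij; exact: leq_trans.
have v0 j : 0 <= v j by rewrite omega_ge0// ltr_pwDl// ltW.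
have [b1|b1] := leP beta 1.
  have hb : 0 < beta <= 1 by rewrite b0.
  pose d l := v l - v l.-1.
  apply: (@le_trans _ _ (11 / 4 * \sum_(1 <= l < n.+1) d l)).
    apply: (kernel_P_conv_le kernel_Ann_gt0 kernel_A_mono) => //.
    - exact: kernel_A_ge0.
    - move=> l /andP[l1 ln]; rewrite subr_ge0 v_le// leq_pred /=.
      by apply: ltnW; apply: leq_trans nN.
    - move=> j /andP[j1 jn]; apply: omega_le_sum_small => //.
      by rewrite j1 ltnW// (leq_trans jn).
  (* Unshifted increments telescope to [v n], because [v 0 = 0]; shifted ones, below, to the last
     value minus [v 1]. *)
  rewrite big_add1 /= (telescope_sumr v)//.
  rewrite {2}/v ht0 omega1D0// subr0.
  have : v n <= v n.+1 by rewrite v_le// leqnSn.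
  have := v0 n.+1; rewrite /v -/beta; lra.
pose d l := v l.+1 - v l.
apply: (@le_trans _ _ (77 / 16 * \sum_(1 <= l < n.+1) d l)).
  apply: (kernel_P_conv_le kernel_Ann_gt0 kernel_A_mono) => //.
  - exact: kernel_A_ge0.
  - move=> l /andP[l1 ln]; rewrite subr_ge0 v_le// leqnSn /=.
    exact: leq_trans nN.
  - move=> j /andP[j1 jn]; apply: omega_le_sum_large; first exact: ltW.
    by rewrite j1 (leq_trans jn).
case: n nN @d => [|n] nN d.
  by rewrite big_geq// mulr0 mulr_ge0//; exact: v0.
rewrite (telescope_sumr v)// ler_wpM2l// -/beta -/(v n.+2).
by rewrite gerBl.
Qed.

Lemma ml_term_omega (mu x : R) (k : nat) : 0 <= x ->
  (mu * x `^ alpha) ^+ k / Gamma (1 + k%:R * alpha) =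
  mu ^+ k * omega (1 + k%:R * alpha) x.
Proof.
move=> x0; rewrite exprMn -mulrA; congr (_ * _); rewrite /omega.
rewrite (_ : 1 + k%:R * alpha - 1 = alpha * k%:R); last by ring.
by rewrite powRrM powR_mulrn// powR_ge0.
Qed.

(** Termwise, summation against [P] sends index [k] of the series to [k + 1]: the missing power of
    [mu] gives [1 / mu], and index 0, never reached, gives the [- 1]. Partial sums with [M] terms
    are compared with [M + 1] terms on the right. *)
Lemma sum_kernel_P_mittag_leffler_le (mu : R) n : 0 < mu -> (n <= N)%N ->
  \sum_(1 <= j < n) P n j * mittag_leffler alpha (mu * t j `^ alpha) <=
  77 / 16 / mu * (mittag_leffler alpha (mu * t n `^ alpha) - 1).
Proof.
move=> mu0 nN.
pose S j (M : nat) := series (fun k : nat =>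
  (mu * t j `^ alpha) ^+ k / Gamma (1 + k%:R * alpha)) M.
have z0 j : 0 <= mu * t j `^ alpha by rewrite mulr_ge0 ?powR_ge0// ltW.
have cS j : S j M @[M --> \oo] --> mittag_leffler alpha (mu * t j `^ alpha).
  exact: ml_series_is_cvg.
have cT : \sum_(1 <= j < n) P n j * S j M @[M --> \oo] -->
    \sum_(1 <= j < n) P n j * mittag_leffler alpha (mu * t j `^ alpha).
  apply: cvg_big => [|j _]; first exact: add_continuous.
  exact: cvgMr.
have z_cvg := cvgP _ cT; rewrite -(cvg_lim _ cT)//; apply: limr_le => //.
apply: nearW => M.
have -> : \sum_(1 <= j < n) P n j * S j M =
    \sum_(0 <= k < M) mu ^+ k *
      \sum_(1 <= j < n) P n j * omega (1 + k%:R * alpha) (t j).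
  rewrite [RHS](eq_bigr (fun k => \sum_(1 <= j < n)
      P n j * (mu ^+ k * omega (1 + k%:R * alpha) (t j)))); last first.
    by move=> k _; rewrite mulr_sumr; apply: eq_big_nat => j _; exact: mulrCA.
  rewrite exchange_big /=; apply: eq_big_nat => j /andP[j1 jn].
  rewrite /S /series /= -mulr_sumr; congr (_ * _).
  apply: eq_bigr => k _; apply: ml_term_omega; apply: mesh_ge0.
  exact: leq_trans (ltnW jn) nN.
apply: (@le_trans _ _ (\sum_(0 <= k < M)
    mu ^+ k * (77 / 16 * omega (1 + k.+1%:R * alpha) (t n)))).
  apply: ler_sum => k _; rewrite ler_wpM2l ?exprn_ge0 ?(ltW mu0)//.
  exact: sum_kernel_P_omega_le.
have -> : \sum_(0 <= k < M) mu ^+ k * (77 / 16 * omega (1 + k.+1%:R * alpha) (t n))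
    = 77 / 16 / mu * (S n M.+1 - 1).
  rewrite /S /series /= big_nat_recl//= expr0 mul0r addr0 Gamma1 divr1.
  rewrite addrAC subrr add0r mulr_sumr; apply: eq_bigr => k _.
  rewrite ml_term_omega; last exact: mesh_ge0.
  move: (omega _ _) => o; rewrite exprS; move: (mu ^+ k) => m.
  by field; rewrite gt_eqF.
rewrite ler_wpM2l ?divr_ge0 ?(ltW mu0)// lerB//.
exact: ml_series_le_mittag_leffler.
Qed.

End mittag_leffler_sums.

(** * The Gronwall inequality *)

Lemma le_max1n (R : realType) (f : nat -> R) n k :
  (1 <= k <= n)%N -> f k <= max1n f n.
Proof.
by move=> kn; rewrite /max1n; apply: le_bigmax_seq => //; rewrite mem_index_iota ltnS.
Qed.

Lemma max1n_le (R : realType) (f : nat -> R) n (B : R) : f 1%N <= B ->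
  (forall k, (1 <= k <= n)%N -> f k <= B) -> max1n f n <= B.
Proof.
move=> f1 fB; rewrite /max1n big_nat; exact: bigmax_le.
Qed.

(** Valid from [m = 0] on, where [max1n] takes its default [f 1]. *)
Lemma max1n_nondecreasing (R : realType) (f : nat -> R) m n :
  (m <= n)%N -> max1n f m <= max1n f n.
Proof.
move=> mn; have f1 : f 1%N <= max1n f n.
  by case: n mn => [|n] mn; [rewrite /max1n big_geq|exact: le_max1n].
apply: max1n_le => // k /andP[k1 km]; apply: le_max1n.
by rewrite k1 (leq_trans km).
Qed.

(* If [w n] is a new maximum, the [j = n] term of the history is absorbed by
   [Lambda * P n n <= 1 / 3]; otherwise the bound is inherited. *)
Lemma discrete_gronwall (R : realType) (N : nat) (P : nat -> nat -> R)
    (E G lambda w : nat -> R) (Lambda K : R) :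
  0 <= Lambda ->
  (forall k, (k <= N)%N -> 0 <= lambda k) ->
  \sum_(0 <= k < N.+1) lambda k <= Lambda ->
  (forall n j, (n <= N)%N -> (1 <= j <= n)%N -> 0 <= P n j) ->
  (forall n, (1 <= n <= N)%N -> Lambda * P n n <= 1 / 3) ->
  (forall n, (n <= N)%N -> 1 <= E n) ->
  (forall m n, (m <= n <= N)%N -> E m <= E n) ->
  2 * Lambda * K <= 1 ->
  (forall n, (n <= N)%N -> \sum_(1 <= j < n) P n j * E j <= K * (E n - 1)) ->
  (forall n, (n <= N)%N -> 0 <= G n) ->
  (forall m n, (m <= n <= N)%N -> G m <= G n) ->
  (forall n, (n <= N)%N -> 0 <= w n) ->
  w 0%N <= G 0%N ->
  (forall n, (1 <= n <= N)%N -> w n <= G n +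
    \sum_(1 <= j < n.+1) P n j * \sum_(0 <= k < j.+1) lambda (j - k)%N * w k) ->
  forall n, (n <= N)%N -> w n <= 2 * E n * G n.
Proof.
move=> L0 lam0 lamL P0 Pnn E1 Emono LK PE G0 Gmono w0 wG hw n.
have hist j B : (j <= N)%N -> 0 <= B ->
    (forall k, (k <= j)%N -> w k <= B) ->
    \sum_(0 <= k < j.+1) lambda (j - k)%N * w k <= Lambda * B.
  move=> jN B0 wB.
  apply: (@le_trans _ _ (\sum_(0 <= k < j.+1) lambda (j - k)%N * B)).
    rewrite !big_nat; apply: ler_sum => k /andP[_]; rewrite ltnS => kj.
    by rewrite ler_wpM2l ?wB// lam0// (leq_trans (leq_subr _ _)).
  rewrite -mulr_suml ler_wpM2r//; apply: le_trans lamL.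
  (* Reversed, the weights are [lambda 0, ..., lambda j], a partial sum of the nonnegative total
     bounded by [Lambda]. *)
  rewrite big_nat_rev /= add0n.
  rewrite (eq_big_nat _ _ (F2 := lambda)); last first.
    by move=> k /andP[_ kj]; rewrite subSS subKn.
  rewrite [leRHS](@big_cat_nat _ _ _ j.+1)//= lerDl.
  rewrite big_nat; apply: sumr_ge0 => k /andP[_]; rewrite ltnS; exact: lam0.
elim/ltn_ind: n => n IH nN.
case: n IH nN => [|n'] IH nN.
  apply: le_trans wG _; rewrite -[leLHS]mul1r ler_wpM2r ?G0//.
  by have := E1 _ nN; lra.
set n := n'.+1 in IH nN *.
have En := E1 _ nN; have Gn := G0 _ nN; have En0 := le_trans ler01 En.
have EG k : (k < n)%N -> 2 * E k * G k <= 2 * E n * G n.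
  move=> kn; have kN := leq_trans (ltnW kn) nN.
  have Ek := le_trans ler01 (E1 _ kN); apply: ler_pM; first exact: mulr_ge0.
  - exact: G0.
  - by rewrite ler_pM2l// Emono// (ltnW kn).
  - by rewrite Gmono// (ltnW kn).
have [[k [kn wk]]|wmax] := pselect (exists k, (k < n)%N /\ w n <= w k).
  apply: le_trans wk _; apply: le_trans (EG _ kn).
  by apply: IH => //; exact: leq_trans (ltnW kn) nN.
have {}wmax k : (k <= n)%N -> w k <= w n.
  rewrite leq_eqVlt => /predU1P[->//|kn]; rewrite leNgt; apply/negP => wk.
  by apply: wmax; exists k; split=> //; exact: ltW.
have := hw n; rewrite nN => /(_ isT); rewrite big_nat_recr//=.
set S := \sum_(1 <= j < n) _; set H := \sum_(0 <= k < n.+1) _ => wn.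
have HL : P n n * H <= 1 / 3 * w n.
  apply: (@le_trans _ _ (P n n * (Lambda * w n))).
    by rewrite ler_wpM2l ?P0 ?leqnn ?andbT//; apply: hist => //; exact: w0.
  by rewrite mulrA ler_wpM2r ?w0// mulrC Pnn// nN.
(* For [j < n] the induction hypothesis bounds the history at [j] by [Lambda * (2 * E j * G n)]; the
   sum of [P n j * E j] and [2 * Lambda * K <= 1] do the rest. *)
have SL : S <= G n * (E n - 1).
  apply: (@le_trans _ _ (2 * Lambda * G n * \sum_(1 <= j < n) P n j * E j)).
    rewrite /S mulr_sumr !big_nat; apply: ler_sum => j /andP[j1 jn].
    have jN := leq_trans (ltnW jn) nN.
    rewrite mulrCA ler_wpM2l ?P0 ?j1 ?(ltnW jn)//.
    rewrite (_ : 2 * Lambda * G n * E j = Lambda * (2 * E j * G n)); last by ring.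
    have Ej := le_trans ler01 (E1 _ jN).
    apply: hist => //; first by rewrite !mulr_ge0.
    move=> k kj; have kn := leq_ltn_trans kj jn.
    have kN := leq_trans kj jN.
    apply: le_trans (IH k kn kN) _; have Ek := le_trans ler01 (E1 _ kN).
    apply: ler_pM; first exact: mulr_ge0.
    - exact: G0.
    - by rewrite ler_pM2l// Emono// kj.
    - by rewrite Gmono// (ltnW kn).
  apply: (@le_trans _ _ (2 * Lambda * G n * (K * (E n - 1)))).
    by rewrite ler_wpM2l ?PE// !mulr_ge0.
  rewrite (_ : 2 * Lambda * G n * (K * (E n - 1)) =
    2 * Lambda * K * (G n * (E n - 1))); last by ring.
  by rewrite ler_piMl// mulr_ge0// subr_ge0.
(* Altogether [w <= G + G (E - 1) + w / 3], so [w <= 3 / 2 * G E], at most [2 G E]. *)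
have GE : 0 <= G n * E n by rewrite mulr_ge0.
rewrite -mulrA [E n * _]mulrC; rewrite mulrBr mulr1 in SL.
move: wn SL HL GE; move: (G n * E n) (P n n * H) (w n) (G n) => ge ph v g.
by clear; lra.
Qed.

Theorem lemma2p6 (R : realType) (alpha theta : R) (N : nat) (T : R)
    (t : nat -> R) (rstar Lambda : R) (lambda xi eta w : nat -> R)
    (halpha : 0 < alpha < 1)
    (htheta : theta = alpha / 2)
    (ht0 : t 0%N = 0)
    (htN : t N = T)
    (hmesh : forall k : nat, (1 <= k <= N)%N -> t k.-1 < t k)
    (hratio : forall k : nat, (2 <= k <= N)%N -> 4 / 7 <= step_ratio t k <= rstar)
    (hLambda : 0 < Lambda)
    (hlambda : forall k : nat, (k <= N)%N -> 0 <= lambda k)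
    (hsum : 0 < \sum_(0 <= k < N.+1) lambda k <= Lambda)
    (hxi : forall k : nat, (1 <= k <= N)%N -> 0 <= xi k)
    (heta : forall k : nat, (1 <= k <= N)%N -> 0 <= eta k)
    (hxi_bounded : exists B : R, forall k : nat, (1 <= k <= N)%N -> xi k <= B)
    (heta_bounded : exists B : R, forall k : nat, (1 <= k <= N)%N -> eta k <= B)
    (hw : forall k : nat, (k <= N)%N -> 0 <= w k)
    (hineq : forall n : nat, (1 <= n <= N)%N ->
      \sum_(1 <= k < n.+1) kernel_A t alpha theta n k * (w k - w k.-1)
        <= \sum_(0 <= k < n.+1) lambda (n - k)%N * w k + xi n + eta n)
    (hstep : forall n : nat, (1 <= n <= N)%N ->
      tau t n <= (4 / (33 * Gamma (2 - alpha) * Lambda)) `^ (1 / alpha)) :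
  (forall n : nat, (1 <= n <= N)%N ->
    w n <= gronwall_const Lambda alpha (t n) *
      (w 0%N + max1n (fun k => \sum_(1 <= j < k.+1)
         kernel_P (kernel_A t alpha theta) k j * (xi j + eta j)) n) /\
    w n <= gronwall_const Lambda alpha (t n) *
      (w 0%N + max1n (fun k => \sum_(1 <= j < k.+1)
         kernel_P (kernel_A t alpha theta) k j * xi j) n
       + 11 / 4 * omega (1 + alpha) (t n) * max1n eta n)) /\
  (forall n : nat, (1 <= n <= N)%N ->
    exists M : R, \forall b \near 1^'-,
      `|gronwall_const Lambda b (t n)| <= M).
Proof.
have /andP[a0 a1] := halpha.
have hratio' k : (2 <= k <= N)%N -> 4 / 7 <= step_ratio t k.
  by move=> /hratio /andP[].
have t0 j : (j <= N)%N -> 0 <= t j by exact: mesh_ge0.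
split; last first.
  move=> n /andP[_ nN]; apply: gronwall_const_bounded; first exact: ltW.
  exact: t0.
set A := kernel_A t alpha theta; set P := kernel_P A.
(* Chosen so that [2 * Lambda * (77 / 16 / mu) = 1]. *)
pose mu := 77 / 8 * Lambda.
have mu0 : 0 < mu by rewrite mulr_gt0.
pose E n := mittag_leffler alpha (mu * t n `^ alpha).
have Agt0 := kernel_Ann_gt0 halpha htheta hmesh hratio'.
have Amono := kernel_A_mono halpha htheta hmesh hratio'.
have P0 n j : (n <= N)%N -> (1 <= j <= n)%N -> 0 <= P n j.
  exact: kernel_P_ge0.
have z0 n : 0 <= mu * t n `^ alpha by rewrite mulr_ge0 ?powR_ge0// ltW.
pose f k := \sum_(1 <= j < k.+1) P k j * (xi j + eta j).
have f0 k : (k <= N)%N -> 0 <= f k.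
  move=> kN; rewrite /f big_nat; apply: sumr_ge0 => j jk.
  have jN : (1 <= j <= N)%N by case/andP: jk => -> jk; exact: leq_trans kN.
  by apply: mulr_ge0; [exact: P0|apply: addr_ge0; [exact: hxi|exact: heta]].
have max0 n : (0 < N)%N -> 0 <= max1n f n.
  move=> N0; apply: le_trans (f0 1%N N0) _.
  case: n => [|n]; first by rewrite /max1n big_geq.
  exact: le_max1n.
have G2 : 0 < Gamma (2 - alpha) by rewrite Gamma_gt0// subr_gt0 (lt_trans a1)// ltr1n.
have Pnn n : (1 <= n <= N)%N -> Lambda * P n n <= 1 / 3.
  move=> nN; have := kernel_Pnn_le halpha htheta hmesh hratio' nN.
  have tau0 : 0 < tau t n by rewrite subr_gt0 hmesh.
  (* [11 / 4 * Gamma (2 - alpha) * c] is [1 / (3 * Lambda)]; raising the step bound to the power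
     [alpha] gives [tau t n ^ alpha <= c]. *)
  set c := 4 / (33 * Gamma (2 - alpha) * Lambda).
  have c0 : 0 < c by rewrite divr_gt0// !mulr_gt0.
  have tc : tau t n `^ alpha <= c.
    rewrite -[leRHS]powRr1 ?(ltW c0)// -(mulVf (lt0r_neq0 a0)) -div1r powRrM.
    by rewrite ge0_ler_powR ?nnegrE ?powR_ge0 ?(ltW a0) ?(ltW tau0)// hstep.
  rewrite -/A -/P => Ple; rewrite -ler_pdivlMl//; apply: le_trans Ple _.
  apply: (@le_trans _ _ (11 / 4 * Gamma (2 - alpha) * c)).
    by rewrite ler_wpM2l// mulr_ge0// ltW.
  rewrite /c; move: (Gamma _) G2 => G G0.
  by rewrite le_eqVlt; apply/orP; left; apply/eqP; field; rewrite !gt_eqF.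
have main n : (1 <= n <= N)%N ->
    w n <= gronwall_const Lambda alpha (t n) * (w 0%N + max1n f n).
  move=> /andP[n1 nN]; have N0 : (0 < N)%N := leq_trans n1 nN.
  rewrite /gronwall_const -/mu -/(E n).
  (* At index 0 the data term is [w 0 + f 1], by the default of [max1n]; it still dominates [w 0]
     and stays below the later values. *)
  apply: (@discrete_gronwall _ N P E (fun k => w 0%N + max1n f k) lambda w
    Lambda (77 / 16 / mu)) => //.
  - exact: ltW.
  - by case/andP: hsum.
  - by move=> k kN; exact: mittag_leffler_ge1.
  - move=> i j /andP[ij jN]; apply: mittag_leffler_le => //.
    rewrite z0 /= ler_pM2l// ge0_ler_powR ?nnegrE ?(ltW a0) ?t0//.
      exact: leq_trans jN.
    by apply: (mesh_le hmesh); rewrite ij.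
  - rewrite /mu le_eqVlt; apply/orP; left; apply/eqP.
    by field; rewrite gt_eqF.
  - by move=> k kN; exact: (sum_kernel_P_mittag_leffler_le halpha htheta ht0 hmesh
      hratio' mu0 kN).
  - by move=> k kN; rewrite addr_ge0 ?hw ?max0.
  - by move=> i j /andP[ij _]; rewrite lerD2l max1n_nondecreasing.
  - by rewrite lerDl max0.
  move=> k /andP[k1 kN].
  (* The telescoped [w k - w 0] is, by [kernel_P_conv], the sum of [P k j] times the left side of
     the assumed inequality at [j]. *)
  have -> : w k = w 0%N + \sum_(1 <= l < k.+1) (w l - w l.-1).
    by rewrite big_add1 /= telescope_sumr// addrC subrK.
  rewrite -addrA lerD2l -(kernel_P_conv Agt0 _ kN).
  apply: (@le_trans _ _ (f k + \sum_(1 <= j < k.+1)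
      P k j * \sum_(0 <= i < j.+1) lambda (j - i)%N * w i)); last first.
    by rewrite lerD2r le_max1n// k1 leqnn.
  rewrite /f -big_split /= !big_nat; apply: ler_sum => j /andP[j1 jk].
  rewrite -mulrDr ler_wpM2l ?P0 ?j1//.
  have := hineq j; rewrite j1 (leq_trans _ kN)// => /(_ isT) h.
  by apply: le_trans h _; rewrite -addrA addrC.
move=> n nN; split; first exact: main.
have /andP[n1 nN'] := nN; have N0 : (0 < N)%N := leq_trans n1 nN'.
apply: le_trans (main n nN) _; rewrite /gronwall_const -/mu -/(E n).
have E0 : 0 <= 2 * E n.
  by rewrite mulr_ge0// (le_trans ler01)// mittag_leffler_ge1.
rewrite ler_wpM2l// -addrA lerD2l.
(* As [P >= 0], the [eta] part is at most its maximum times the sum of [P k j], which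
   [sum_kernel_P_le] bounds by [omega (1 + alpha)] at [t k <= t n]. *)
have bound k : (1 <= k <= n)%N -> f k <=
    max1n (fun k => \sum_(1 <= j < k.+1) P k j * xi j) n +
    11 / 4 * omega (1 + alpha) (t n) * max1n eta n.
  move=> kn; have /andP[k1 kn'] := kn; have kN := leq_trans kn' nN'.
  have M0 : 0 <= max1n eta n.
    by apply: le_trans (heta 1%N _) (le_max1n _ _).
  have -> : f k = \sum_(1 <= j < k.+1) P k j * xi j
                + \sum_(1 <= j < k.+1) P k j * eta j.
    by rewrite /f -big_split /=; apply: eq_bigr => j _; exact: mulrDr.
  apply: lerD.
    exact: (@le_max1n _ (fun k => \sum_(1 <= j < k.+1) P k j * xi j)).
  apply: (@le_trans _ _ ((\sum_(1 <= j < k.+1) P k j) * max1n eta n)).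
    rewrite mulr_suml !big_nat; apply: ler_sum => j /andP[j1 jk].
    rewrite ler_wpM2l ?P0 ?j1// le_max1n// j1.
    by apply: leq_trans kn'.
  rewrite ler_wpM2r//.
  apply: le_trans (sum_kernel_P_le halpha htheta ht0 hmesh hratio' kN) _.
  rewrite ler_wpM2l// omega1D_le ?(ltW a0)// t0//=.
  by apply: (mesh_le hmesh); rewrite kn'.
by apply: max1n_le => //; apply: bound; rewrite n1.
Qed.
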